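(* Let $\Omega\subseteq\mathbb R^n$, $n\ge1$, be a connected open set and let $V\in L^n_{loc}(\Omega)$. Let $u=(u_1,\ldots,u_M):\Omega\to\mathbb R^M$ be a locally Lipschitz function on $\Omega$ satisfying $|\nabla u|\le V|u|$ a.e. on $\Omega$. If $u(x_0)=0$ at some $x_0\in\Omega$, then $u\equiv0$ on $\Omega$.
   Context: A function is locally Lipschitz on $\Omega$ if every point of $\Omega$ has a neighborhood in $\Omega$ on which the function is Lipschitz; by Rademacher's theorem $\nabla u$ then exists a.e. For $u:\Omega\to\mathbb R^M$, $|u|=\left(\sum_{k=1}^M|u_k|^2\right)^{1/2}$ and $|\nabla u|=\left(\sum_{j=1}^n\sum_{k=1}^M|\partial_{x_j}u_k|^2\right)^{1/2}$. *)

(* Defs.v *)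
From HB Require Import structures.
From mathcomp Require Import all_boot all_order all_algebra.
From mathcomp Require Import all_classical all_reals all_analysis.

Set Implicit Arguments.
Unset Strict Implicit.
Unset Printing Implicit Defensive.

Import Order.TTheory GRing.Theory Num.Theory.
Import numFieldNormedType.Exports.

Local Open Scope classical_set_scope.
Local Open Scope ring_scope.

(* R^n is the type 'rV[R]_n of row vectors. The library's norm on 'rV[R]_n is
   the sup norm: it induces the usual topology, but the lengths of vectors in
   the sequel are Euclidean. *)

Section euclidean_norm.
Context {R : realType}.

Definition enorm (m : nat) (v : 'rV[R]_m) : R :=
  Num.sqrt (\sum_(i < m) v 0 i ^+ 2).

(* 'D_v is total: its value is junk where the derivative does not exist. For a
   locally Lipschitz u this is a null set, by Rademacher's theorem. *)
Definition partial (n m : nat) (u : 'rV[R]_n -> 'rV[R]_m) (k : 'I_m) (j : 'I_n)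
    (x : 'rV[R]_n) : R :=
  'D_(delta_mx 0 j) (fun y => u y 0 k) x.

Definition grad_norm (n m : nat) (u : 'rV[R]_n -> 'rV[R]_m) (x : 'rV[R]_n) : R :=
  Num.sqrt (\sum_(j < n) \sum_(k < m) partial u k j x ^+ 2).

Definition lipschitz_set (n m : nat) (U : set 'rV[R]_n)
    (u : 'rV[R]_n -> 'rV[R]_m) : Prop :=
  exists L : R, forall x y, U x -> U y -> enorm (u x - u y) <= L * enorm (x - y).

Definition locally_lipschitz (n m : nat) (Om : set 'rV[R]_n)
    (u : 'rV[R]_n -> 'rV[R]_m) : Prop :=
  forall x, Om x ->
    exists U, [/\ nbhs x U, U `<=` Om & lipschitz_set U u].

End euclidean_norm.

(* Lebesgue measure on R^n, n >= 1: Caratheodory's restriction of the outer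
   measure given by countable covers by half-open boxes. A box is empty, and
   its volume is 0, as soon as b_i <= a_i for some i; this is why n is
   positive (for n = 0 the empty set would not be null). *)

Section lebesgue_outer_measure.
Context {R : realType} (n : nat).
Local Notation T := 'rV[R]_n.+1.

Definition box (ab : T * T) : set T :=
  [set x | forall i, ab.1 0 i < x 0 i <= ab.2 0 i].

Definition box_volume (ab : T * T) : R :=
  \prod_(i < n.+1) Num.max 0 (ab.2 0 i - ab.1 0 i).

Definition box_cover (A : set T) : set (nat -> T * T) :=
  [set F | A `<=` \bigcup_k box (F k)].

Local Open Scope ereal_scope.

Definition lebesgue_outer (A : set T) : \bar R :=
  ereal_inf [set \sum_(k <oo) (box_volume (F k))%:E | F in box_cover A].

Let box_volume_ge0 ab : 0 <= (box_volume ab)%:E.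
Proof. by rewrite lee_fin; apply: prodr_ge0 => i _; rewrite le_max lexx. Qed.

Let lebesgue_outer_ge0 A : 0 <= lebesgue_outer A.
Proof. by apply: le_ereal_inf_tmp => x [F _ <-]; exact: nneseries_ge0. Qed.

Let lebesgue_outer0 : lebesgue_outer set0 = 0.
Proof.
apply/eqP; rewrite eq_le lebesgue_outer_ge0 andbT.
apply: ereal_inf_lbound; exists (fun=> (0%R, 0%R)) => //.
apply: eseries0 => k _ _.
by rewrite /box_volume big_ord_recl /= subrr maxxx mul0r.
Qed.

Let le_lebesgue_outer : {homo lebesgue_outer : A B / A `<=` B >-> A <= B}.
Proof.
move=> A B AB; apply/ereal_inf_le_tmp => x [F BF <-{x}].
by exists F => //; exact: subset_trans AB BF.
Qed.

Let lebesgue_outer_sigma_subadditive : sigma_subadditive lebesgue_outer.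
Proof.
move=> A; have [[i ioo]|] := pselect (exists i, lebesgue_outer (A i) = +oo).
  rewrite (eseries_pinfty _ _ ioo) ?leey// => k _.
  by rewrite -ltNye (lt_le_trans _ (lebesgue_outer_ge0 _)).
rewrite -forallNE => Aoo.
suff add2e (e : {posnum R}) : lebesgue_outer (\bigcup_n A n) <=
    \sum_(i <oo) lebesgue_outer (A i) + e%:num%:E.
  by apply/lee_addgt0Pr => _/posnumP[].
rewrite (le_trans _ (epsilon_trick _ _ _))//.
pose P k (F : nat -> T * T) := box_cover (A k) F /\
  \sum_(i <oo) (box_volume (F i))%:E <=
    lebesgue_outer (A k) + (e%:num / (2 ^ k.+1)%:R)%:E.
have [G PG] : {G : nat -> nat -> T * T & forall k, P k (G k)}.
  apply: (@choice _ _ P) => k; rewrite /P /lebesgue_outer.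
  set S := (X in ereal_inf X); move infS : (ereal_inf S) => iS.
  case: iS infS => [r Sr|Soo|Soo].
  - have ek : (0 < e%:num / (2 ^ k.+1)%:R)%R by [].
    have /(lb_ereal_inf_adherent ek) : ereal_inf S \is a fin_num by rewrite Sr.
    move=> [x [F AF Fx] xS].
    by exists F; split => //; rewrite Fx -Sr; exact/ltW.
  - by have := Aoo k; rewrite /lebesgue_outer Soo.
  - by have := lebesgue_outer_ge0 (A k); rewrite /lebesgue_outer Soo.
pose vol ab := (box_volume ab)%:E.
have volG_ge0 x : 0 <= (vol \o uncurry G) x by exact: box_volume_ge0.
apply: (@le_trans _ _ (\esum_(i in setT) (vol \o uncurry G) i)).
  apply: ereal_inf_lbound => /=.
  have /card_esym/ppcard_eqP[f] := card_nat2.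
  exists (uncurry G \o f).
    move=> t [i _ /(PG i).1[j _ Gijt]]; exists (f^-1%FUN (i, j)) => //=.
    by rewrite invK ?inE.
  rewrite -(esum_pred_image (vol \o uncurry G) _ xpredT) ?[fun=> _]set_true//.
  by rewrite image_eq.
rewrite (_ : esum _ _ = \sum_(i <oo) \sum_(j <oo) vol (G i j)); last first.
  pose J : nat -> set (nat * nat) := fun i => [set (i, j) | j in setT].
  rewrite (_ : setT = \bigcup_k J k); last first.
    by rewrite predeqE => -[a b]; split => // _; exists a => //; exists b.
  rewrite esum_bigcupT /=; last 2 first.
    - apply/trivIsetP => i j _ _ ij.
      rewrite predeqE => -[k m] /=; split => //= -[] [_] _ [<-{k} _].
      by move=> [m' _] [] /esym/eqP; rewrite (negbTE ij).
    - by move=> /= [k m]; exact: volG_ge0.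
  rewrite (_ : setT = id @` xpredT); last first.
    by rewrite image_id funeqE => x; rewrite trueE.
  rewrite esum_pred_image //; last first.
    by move=> k _; apply: esum_ge0 => ij _; exact: volG_ge0.
  apply: eq_eseriesr => /= j _.
  rewrite -(esum_pred_image (vol \o uncurry G) (pair j) predT)//=.
  - by congr esum; rewrite predeqE => -[a b]; split; move=> [i _ <-]; exists i.
  - by move=> i _; exact: (volG_ge0 (j, i)).
  - by move=> ? ? _ _; exact: (@can_inj _ _ _ snd).
apply: lee_lim.
- apply: is_cvg_nneseries => k *; apply: nneseries_ge0 => i *.
  exact: (volG_ge0 (k, i)).
- by apply: is_cvg_nneseries => *; apply: adde_ge0.
- by near=> m; apply: lee_sum => i _; exact: (PG i).2.
Unshelve. all: by end_near. Qed.

HB.instance Definition _ := isOuterMeasure.Build R T lebesgue_outer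
  lebesgue_outer0 lebesgue_outer_ge0 le_lebesgue_outer
  lebesgue_outer_sigma_subadditive.

End lebesgue_outer_measure.

(* R^n with the sigma-algebra of Lebesgue (not only Borel) measurable sets *)
Definition measurableRn (R : realType) (n : nat) :=
  caratheodory_type (@lebesgue_outer R n).

HB.instance Definition _ (R : realType) (n : nat) :=
  Measurable.on (measurableRn R n).

Definition lebesgue_Rn (R : realType) (n : nat) :
    set (measurableRn R n) -> \bar R :=
  @lebesgue_outer R n.

HB.instance Definition _ (R : realType) (n : nat) :=
  isMeasure.Build _ _ _ (@lebesgue_Rn R n)
    (@caratheodory_measure0 R _ (@lebesgue_outer R n))
    (@caratheodory_measure_ge0 R _ (@lebesgue_outer R n))
    (@caratheodory_measure_sigma_additive R _ (@lebesgue_outer R n)).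

Definition Lploc (R : realType) (n p : nat) (Om : set 'rV[R]_n.+1)
    (V : 'rV[R]_n.+1 -> R) : Prop :=
  measurable_fun (Om : set (measurableRn R n)) V /\
  forall K, K `<=` Om -> compact K ->
    (\int[@lebesgue_Rn R n]_(x in K) (`|V x| ^+ p)%:E < +oo)%E.

(* Main.v *)
(** The logarithm [w] of [(eps^2 + |u|^2)^(1/2)] satisfies [|grad w| <= V] a.e.,
    uniformly in [eps]. By Hoelder's inequality its means over cubes of sides
    [s] and [s / 2] then differ by at most a multiple of the [L^n] norm of [V]
    on the larger cube, which tends to 0 with [s]; so at a fixed corner the mean
    drifts by [o(k)] over [k] halvings. At a zero [z] of [u] take
    [eps = s / 2^k]: on the cube of side [eps] one has [w <= ln eps + O(1)],
    hence the mean over the cube of side [s] is at most [- k ln 2 + o(k)]. The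
    means over two neighbouring cubes of the same fixed side differ by [O(1)],
    so [u] cannot be nonzero at a point near [z]. The zero set is therefore
    open, and closed, in the connected set [Om].

    Since derivatives are only known a.e. and [V] is only integrable, the
    gradient bound enters through translations along the axes: the integral of
    [|w (x + h e_j) - w x|] is at most [h] times that of [V]. Existence of the
    partial derivatives a.e. comes from the one-dimensional theorem (a Lipschitz
    function has a density, by Radon-Nikodym) and Fubini. *)
Require Import Defs.
From HB Require Import structures.
From mathcomp Require Import all_boot all_order all_algebra.
From mathcomp Require Import all_classical all_reals all_analysis.
From mathcomp Require Import measurable_realfun ring lra.

Set Implicit Arguments.
Unset Strict Implicit.
Unset Printing Implicit Defensive.

Import Order.TTheory GRing.Theory Num.Theory.
Import numFieldNormedType.Exports.

Local Open Scope classical_set_scope.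
Local Open Scope ring_scope.

(** * Lebesgue outer measure: translations and half-spaces *)

Section lebesgue_outer_boxes.
Context {R : realType} {n : nat}.
Local Notation T := 'rV[R]_n.+1.
Implicit Types (a b v x : T) (A : set T).

Lemma box_volume_ge0 (ab : T * T) : 0 <= box_volume ab.
Proof. by apply: prodr_ge0 => i _; rewrite le_max lexx. Qed.

Lemma lebesgue_outer_box_le (ab : T * T) :
  (lebesgue_outer (box ab) <= (box_volume ab)%:E)%E.
Proof.
pose F k : T * T := if k is 0%N then ab else (0, 0).
apply: ereal_inf_lbound; exists F; first by move=> x abx; exists 0%N.
rewrite nneseries_recl//; last by move=> k _; rewrite lee_fin box_volume_ge0.
rewrite eseries0 ?adde0// => -[|k]// _ _.
by rewrite /box_volume big_ord_recl /= subrr maxxx mul0r.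
Qed.

Lemma lebesgue_outer_translate_le v A :
  (lebesgue_outer [set x | A (x + v)%R] <= lebesgue_outer A)%E.
Proof.
apply/ereal_inf_le_tmp => x [F AF <-{x}].
exists (fun k => ((F k).1 - v, (F k).2 - v)).
  move=> x /= /AF[k _ Fk]; exists k => // i.
  by have := Fk i; rewrite !mxE ltrBlDr lerBrDr.
apply: eq_eseriesr => k _; congr EFin; rewrite /box_volume/=.
by apply: eq_bigr => i _; rewrite !mxE; congr Num.max; ring.
Qed.

Lemma lebesgue_outer_translate v A :
  lebesgue_outer [set x | A (x + v)] = lebesgue_outer A.
Proof.
apply/eqP; rewrite eq_le lebesgue_outer_translate_le/=.
rewrite -[leLHS](_ : lebesgue_outer [set x | A (x - v + v)%R] = _).
  exact: (@lebesgue_outer_translate_le (- v) [set x | A (x + v)]).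
by congr lebesgue_outer; apply/seteqP; split => x /=; rewrite subrK.
Qed.

Lemma caratheodory_translate v A :
  caratheodory_measurable (@lebesgue_outer R n) A ->
  caratheodory_measurable (@lebesgue_outer R n) [set x | A (x + v)].
Proof.
move=> mA X; rewrite -(lebesgue_outer_translate (- v) X).
rewrite -(lebesgue_outer_translate (- v) (_ `&` [set _ | _])).
rewrite -(lebesgue_outer_translate (- v) (_ `&` ~` _)).
rewrite [LHS]mA; congr (_ + _)%E; congr lebesgue_outer;
  by apply/seteqP; split => x /=; rewrite subrK.
Qed.

Definition half_space (i : 'I_n.+1) (c : R) : set T := [set x | x 0 i <= c].

(** The hyperplane of equation [x 0 i = c] cuts each covering box into two boxes, [lo] and [hi],
    whose volumes add up. A cover of [X] thus splits, at no extra cost, into covers of its two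
    parts. When the hyperplane misses a box, one piece is empty and the maximum in [box_volume]
    gives it volume 0. *)
Lemma caratheodory_half_space i c :
  caratheodory_measurable (@lebesgue_outer R n) (half_space i c).
Proof.
apply: le_caratheodory_measurable => X.
apply: le_ereal_inf_tmp => _ [F XF <-].
pose lo k : T * T := ((F k).1,
  \row_j if j == i then Num.min ((F k).2 0 j) c else (F k).2 0 j).
pose hi k : T * T := (\row_j if j == i then Num.max ((F k).1 0 j) c
  else (F k).1 0 j, (F k).2).
rewrite (eq_eseriesr (g := fun k =>
    ((box_volume (lo k))%:E + (box_volume (hi k))%:E)%E)); last first.
  move=> k _; rewrite -EFinD; congr EFin; rewrite /box_volume.
  rewrite (bigD1 i)//= [in X in _ = X + _](bigD1 i)//= [in X in _ = _ + X](bigD1 i)//=.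
  rewrite !mxE eqxx.
  under [in X in _ = X + _]eq_bigr => j /negbTE ji do rewrite mxE ji.
  under [in X in _ = _ + X]eq_bigr => j /negbTE ji do rewrite mxE ji.
  rewrite -mulrDl; congr (_ * _).
  move: ((F k).1 0 i) ((F k).2 0 i) => p q; rewrite /Num.max /Num.min.
  by repeat case: ifP; lra.
rewrite nneseriesD; [|by move=> *; rewrite lee_fin box_volume_ge0..].
apply: leeD.
  apply: ereal_inf_lbound; exists lo => //.
  move=> x [/XF[k _ Fk] xc]; exists k => // j.
  have /andP[pj qj] := Fk j; rewrite /lo/= pj mxE/=.
  by case: eqP qj => // -> qj; rewrite le_min qj.
apply: ereal_inf_lbound; exists hi => //.
move=> x [/XF[k _ Fk]]; rewrite /half_space/= => /negP; rewrite -ltNge => xc.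
exists k => // j.
have /andP[pj qj] := Fk j; rewrite /hi/= qj mxE/= andbT.
by case: eqP pj => // -> ?; rewrite gt_max; apply/andP.
Qed.

End lebesgue_outer_boxes.

Lemma norm_coord_le {R : realType} m (x : 'rV[R]_m) i : `|x 0 i| <= `|x|.
Proof.
rewrite [leRHS]/Num.norm/= mx_normrE.
exact: (le_bigmax _ (fun ij : 'I_1 * 'I_m => `|x ij.1 ij.2|) (0, i)).
Qed.

(** * Measurability of vector-valued maps, coordinate by coordinate *)

Section measurability_in_coordinates.
Context {R : realType}.

Lemma measurable_fun_gt d (X : measurableType d) (D : set X) (g : X -> R) :
  (forall c, measurable (D `&` [set x | c < g x])) -> measurable_fun D g.
Proof.
move=> mg; apply: (measurability _ (RGenOInfty.measurableE R)) => _ [_ [c ->]] <-.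
rewrite (_ : D `&` _ = D `&` [set x | c < g x]) //.
by apply/seteqP; split => x [Dx] /=; rewrite in_itv/= andbT.
Qed.

(** [O] is the union of the countably many balls with rational centre and radius [k.+1%:R^-1] that
    it contains. A ball of the sup norm is a product of intervals, so its preimage is a finite
    intersection of preimages under the coordinates. *)
Lemma open_preimage_measurable d (X : measurableType d) m (f : X -> 'rV[R]_m)
    (O : set 'rV[R]_m) : open O ->
  (forall i, measurable_fun [set: X] (fun x => f x 0 i)) ->
  measurable (f @^-1` O).
Proof.
move=> oO mf; pose c (p : 'rV[rat]_m * nat) : 'rV[R]_m := map_mx ratr p.1.
pose r (p : 'rV[rat]_m * nat) : R := p.2.+1%:R^-1.
have r_gt0 p : 0 < r p by rewrite invr_gt0.
pose good := [set p | ball (c p) (r p) `<=` O].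
pose F p := [set x | good p /\ forall i, ball (c p 0 i) (r p) (f x 0 i)].
have -> : f @^-1` O = \bigcup_p F p.
  apply/seteqP; split => [x Ofx|x [p _ [gp fp]]]; last first.
    by apply: gp; split=> // i j; rewrite (ord1 i).
  have /nbhs_ballP[e /= e0 eO] : nbhs (f x) O by exact: open_nbhs_nbhs.
  have [k ke] : exists k : nat, k.+1%:R^-1 < e / 2 :> R.
    have /archi_boundP := divr_ge0 (@ler0n R 2) (ltW e0).
    set k := Num.bound _ => ke; exists k.
    rewrite invf_plt ?posrE ?divr_gt0// invfM invrK mulrC.
    by rewrite (lt_trans ke)// ltr_nat.
  have [q qf] : exists q : 'rV[rat]_m, forall i, `|ratr (q 0 i) - f x 0 i| < k.+1%:R^-1.
    have /choice[q qf] :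
        forall i, exists q : rat, `|ratr q - f x 0 i| < k.+1%:R^-1.
      move=> i.
      have [|q] := @rat_in_itvoo R (f x 0 i) (f x 0 i + k.+1%:R^-1).
        by rewrite ltrDl invr_gt0.
      rewrite in_itv/= => /andP[h1 h2]; exists q.
      by rewrite ger0_norm ?subr_ge0 ?ltW// ltrBlDl.
    by exists (\row_i q i) => i; rewrite mxE.
  exists (q, k) => //; split => [y [_ yc]|i]; last first.
    by rewrite /ball/= mxE; exact: qf.
  apply: eO; split => // i j; rewrite (ord1 i); have := yc 0 j.
  rewrite /ball/= mxE /r/= => h; have := qf j; rewrite distrC => h'.
  rewrite -(subrKA (ratr (q 0 j))) (le_lt_trans (ler_normD _ _))//.
  by rewrite (splitr e) ltrD// (lt_trans _ ke)//.
apply: countable_bigcupT_measurable => [|p]; first exact: countableP.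
have [gp|ngp] := pselect (good p); last first.
  rewrite (_ : F p = set0); first exact: measurable0.
  by apply/seteqP; split => // x [].
rewrite (_ : F p = \bigcap_(i in [set: 'I_m])
    ((fun x => f x 0 i) @^-1` ball (c p 0 i) (r p))); last first.
  by apply/seteqP; split => x; [move=> [_ h] i _; exact: h|
    move=> h; split => // i; exact: h].
apply: fin_bigcap_measurable => [|i _]; first exact: finite_finset.
rewrite -[X in measurable X]setTI; apply: mf => //.
exact: measurable_ball.
Qed.

Lemma continuous_comp_measurable d (X : measurableType d) m (f : X -> 'rV[R]_m)
    (g : 'rV[R]_m -> R) : continuous g ->
  (forall i, measurable_fun [set: X] (fun x => f x 0 i)) ->
  measurable_fun [set: X] (g \o f).
Proof.
move=> cg mf; apply: measurable_fun_gt => c; rewrite setTI.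
apply: (@open_preimage_measurable _ _ _ f [set y | c < g y]) => //.
have /continuousP/(_ _ (@open_gt R c)) := cg.
by congr open; apply/seteqP; split.
Qed.

End measurability_in_coordinates.

(** * Lebesgue measurable sets and sigma-finiteness *)

Section lebesgue_Rn_theory.
Context {R : realType} {n : nat}.
Local Notation T := 'rV[R]_n.+1.
Local Notation Rn := (measurableRn R n).
Local Notation mu := (@lebesgue_Rn R n).
Implicit Types (a b v x : T).

Lemma measurable_half_space i c : measurable (half_space i c : set Rn).
Proof. exact: caratheodory_half_space. Qed.

Lemma measurable_coord i : measurable_fun [set: Rn] (fun x : Rn => (x : T) 0 i).
Proof.
apply: measurable_fun_gt => c; rewrite setTI.
rewrite (_ : mkset _ = ~` (half_space i c : set Rn)).
  exact/measurableC/measurable_half_space.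
by apply/seteqP; split => x /=; rewrite /half_space/= ltNge => /negP.
Qed.

Lemma open_measurable_Rn (O : set T) : open O -> measurable (O : set Rn).
Proof.
move=> oO; exact: (@open_preimage_measurable R _ Rn _ idfun _ oO measurable_coord).
Qed.

Lemma continuous_measurable_Rn (g : T -> R) : continuous g ->
  measurable_fun [set: Rn] (g : Rn -> R).
Proof.
move=> cg; exact: (@continuous_comp_measurable R _ Rn _ idfun _ cg measurable_coord).
Qed.

Lemma measurable_box (ab : T * T) : measurable (box ab : set Rn).
Proof.
rewrite (_ : box ab = \bigcap_(i in [set: 'I_n.+1])
  ((half_space i (ab.2 0 i) : set Rn) `\` half_space i (ab.1 0 i))).
  apply: fin_bigcap_measurable => [|i _]; first exact: finite_finset.
  by apply: measurableD; exact: measurable_half_space.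
apply/seteqP; split => x.
  move=> h i _; have /andP[h1 h2] := h i.
  by split => //; rewrite /half_space/=; apply/negP; rewrite -ltNge.
move=> h i; have [] := h i I; rewrite /half_space/= => -> /negP.
by rewrite -ltNge andbT.
Qed.

Lemma lebesgue_Rn_box_lty (ab : T * T) : (mu (box ab) < +oo)%E.
Proof. exact: le_lt_trans (lebesgue_outer_box_le ab) (ltry _). Qed.

Lemma lebesgue_Rn_translate v (A : set Rn) :
  mu [set x : Rn | A ((x : T) + v)] = mu A.
Proof. exact: lebesgue_outer_translate. Qed.

Lemma measurable_translate v (A : set Rn) : measurable A ->
  measurable [set x : Rn | A ((x : T) + v)].
Proof. exact: caratheodory_translate. Qed.

Lemma sigma_finite_lebesgue_Rn : sigma_finite setT mu.
Proof.
exists (fun k => box (- const_mx k%:R, const_mx k%:R)) => [|k]; last first.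
  by split; [exact: measurable_box|exact: lebesgue_Rn_box_lty].
apply/esym/seteqP; split => // x _.
exists (Num.bound `|x|).+1 => // i; rewrite !mxE.
rewrite -[_ && _](_ : - (Num.bound `|x|).+1%:R < x 0 i <= (Num.bound `|x|).+1%:R = _)//.
have : `|x 0 i| < (Num.bound `|x|).+1%:R.
  apply: (@le_lt_trans _ _ `|x|); first exact: (norm_coord_le).
  by apply: (lt_trans (archi_boundP _)) => //; rewrite ltr_nat.
by rewrite ltr_norml => /andP[-> /ltW].
Qed.

End lebesgue_Rn_theory.

HB.instance Definition _ (R : realType) (n : nat) :=
  Measure_isSigmaFinite.Build _ _ R (@lebesgue_Rn R n) sigma_finite_lebesgue_Rn.

(** * The measure of a box is its volume *)

Section lebesgue_Rn_box.
Context {R : realType} {n : nat}.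
Local Notation T := 'rV[R]_n.+1.
Local Notation leb := (@lebesgue_measure R).

(* The indicator of a box integrated over its first m coordinates. *)
Let partial_volume (m : nat) (ab : T * T) (x : T) : R :=
  \prod_(i < n.+1) if (i < m)%N then Num.max 0 (ab.2 0 i - ab.1 0 i)
                   else \1_`]ab.1 0 i, ab.2 0 i] (x 0 i).

Let partial_volume_ge0 m ab x : 0 <= partial_volume m ab x.
Proof. by apply: prodr_ge0 => i _; case: ifP => // _; rewrite le_max lexx. Qed.

Let partial_volume0 ab x : partial_volume 0 ab x = \1_(box ab) x.
Proof.
have [abx|/existsNP[i /negP abx]] := pselect (box ab x).
  rewrite indicE mem_set// /partial_volume big1// => i _ /=.
  by rewrite indicE mem_set//= in_itv; exact: abx.
rewrite indicE memNset; last by move=> /(_ i); exact/negP.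
rewrite /partial_volume (bigD1 i)//= indicE memNset ?mul0r//= in_itv/=.
exact/negP.
Qed.

Let slice (x : T) (i : 'I_n.+1) (t : R) : T :=
  \row_j if j == i then t else x 0 j.

(** Only the factor of index [i] depends on [t], and the integral of that indicator is the length of
    the edge. *)
Let integral_partial_volume (i : 'I_n.+1) ab x :
  (\int[leb]_t (partial_volume i ab (slice x i t))%:E =
   (partial_volume i.+1 ab x)%:E)%E.
Proof.
pose c := \prod_(j < n.+1 | j != i) if (j < i)%N
  then Num.max 0 (ab.2 0 j - ab.1 0 j)
  else \1_`]ab.1 0 j, ab.2 0 j] (x 0 j) : R.
have c0 : 0 <= c.
  by apply: prodr_ge0 => j _; case: ifP => // _; rewrite le_max lexx.
transitivity (\int[leb]_t (c * \1_`]ab.1 0 i, ab.2 0 i] t)%:E)%E.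
  apply: eq_integral => t _; congr EFin; rewrite /partial_volume (bigD1 i)//= ltnn mulrC.
  congr (_ * _); last by rewrite /slice mxE eqxx.
  by apply: eq_bigr => j /negbTE ji; rewrite /slice mxE ji.
under eq_integral do rewrite EFinM.
rewrite ge0_integralZl_EFin//; last exact/measurable_EFinP/measurable_indic.
rewrite integral_indic// setIT.
rewrite -[X in (_ * X)%E]/(leb _) lebesgue_measure_itv/= lte_fin.
rewrite /partial_volume (bigD1 i)//= ltnS leqnn mulrC.
rewrite (_ : \prod_(_ < _ | _) _ = c); last first.
  by apply: eq_bigr => j ji; rewrite ltnS ltn_neqAle ji.
rewrite EFinM; congr (_ * _)%E.
rewrite /Num.max subr_gt0; case: ifP => //.
Qed.

(** The inclusion is an inequality between indicator functions, the case [m = 0]. Integrating it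
    over one coordinate after the other, with the countable sum passing through each integral, leads
    to the volumes. *)
Lemma box_cover_volume_le (ab : T * T) (F : nat -> T * T) :
  box_cover (box ab) F ->
  ((box_volume ab)%:E <= \sum_(k <oo) (box_volume (F k))%:E)%E.
Proof.
move=> abF.
have step m : (m <= n.+1)%N -> forall x, ((partial_volume m ab x)%:E <=
    \sum_(k <oo) (partial_volume m (F k) x)%:E)%E.
  elim: m => [_ x|m IH mn x].
    under eq_eseriesr do rewrite partial_volume0.
    rewrite partial_volume0.
    have [abx|abx] := pselect (box ab x); last first.
      rewrite indicE memNset//; apply: nneseries_ge0 => k _ _.
      by rewrite lee_fin.
    have [k _ Fkx] := abF _ abx.
    apply: (@le_trans _ _ (\1_(box (F k)) x)%:E).
      by rewrite !indicE !mem_set.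
    rewrite (@nneseriesD1 _ _ k)// ?leeDl ?nneseries_ge0// => *;
      by rewrite lee_fin.
  have mfm k : measurable_fun [set: measurableTypeR R] (fun t =>
      (partial_volume m k (slice x (Ordinal mn) t))%:E).
    apply/measurable_EFinP; rewrite /partial_volume.
    apply: (@measurable_prod _ (measurableTypeR R)) => i _.
    case: (i < m)%N => //; rewrite /slice.
    under eq_fun do rewrite mxE.
    case: (i == Ordinal mn) => //; last exact: measurable_cst.
    by apply: measurable_indic.
  rewrite -(integral_partial_volume (Ordinal mn)).
  under eq_eseriesr do rewrite -(integral_partial_volume (Ordinal mn)).
  rewrite -integral_nneseries//; last by move=> k t _; rewrite lee_fin.
  apply: ge0_le_integral => //.
  - by move=> t _; rewrite lee_fin.
  - by apply: ge0_emeasurable_sum => // k t _ _; rewrite lee_fin.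
  - by move=> t _; apply: IH; exact: ltnW.
have volE cd x : partial_volume n.+1 cd x = box_volume cd.
  by apply: eq_bigr => i _; rewrite ltn_ord.
(* The point 0 is arbitrary: once all coordinates are integrated, nothing depends on it. *)
have := step n.+1 (leqnn _) 0; rewrite volE.
by under eq_eseriesr do rewrite volE.
Qed.

Lemma lebesgue_Rn_box (ab : T * T) :
  @lebesgue_Rn R n (box ab) = (box_volume ab)%:E.
Proof.
apply/eqP; rewrite eq_le lebesgue_outer_box_le/=.
by apply: le_ereal_inf_tmp => _ [F abF <-]; exact: box_cover_volume_le.
Qed.

End lebesgue_Rn_box.

(** * Translation of integrals, and null sets by sections along an axis *)

Section lebesgue_Rn_translation.
Context {R : realType} {n : nat}.
Local Notation T := 'rV[R]_n.+1.
Local Notation Rn := (measurableRn R n).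
Local Notation mu := (@lebesgue_Rn R n).
Local Notation leb := (@lebesgue_measure R).
Implicit Types (v x : T).

Lemma measurable_fun_translate v : measurable_fun [set: Rn]
  (fun x : Rn => (x : T) + v : Rn).
Proof. by move=> _ A mA; rewrite setTI; exact: measurable_translate. Qed.

Lemma ge0_integral_translate v (D : set Rn) (f : Rn -> \bar R) :
  measurable D -> measurable_fun D f -> (forall x, D x -> (0 <= f x)%E) ->
  (\int[mu]_(x in D) f x =
   \int[mu]_(x in [set x : Rn | D ((x : T) + v)%R]) f ((x : T) + v)%R)%E.
Proof.
move=> mD mf f0.
rewrite -(@ge0_integral_pushforward _ _ _ _ _ _ (measurable_fun_translate v)
  mu D f)//; last by move=> x /set_mem; exact: f0.
apply: eq_measure_integral; first exact: measurable_fun_translate.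
by move=> ? A mA _; exact: (esym (lebesgue_Rn_translate v A)).
Qed.

Lemma Rintegral_translate v (D : set Rn) (f : Rn -> R) :
  measurable D -> measurable_fun [set: Rn] f ->
  (\int[mu]_(x in D) f x =
   \int[mu]_(x in [set x : Rn | D ((x : T) + v)%R]) f ((x : T) + v))%R.
Proof.
move=> mD mf; rewrite /Rintegral; congr fine.
have mf' : measurable_fun D (EFin \o f).
  by apply/measurable_EFinP; exact: measurable_funTS.
rewrite integralE [RHS]integralE; congr (_ - _)%E.
  rewrite (@ge0_integral_translate v)//; last exact: measurable_funepos.
  by apply: eq_integral => x _; rewrite ?funeposE ?funenegE.
rewrite (@ge0_integral_translate v)//; last exact: measurable_funeneg.
by apply: eq_integral => x _; rewrite ?funeposE ?funenegE.
Qed.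

(** The sets with measurable preimage form a sigma-algebra containing the open sets. Lebesgue
    measurability of [A] would not do: along a line, a null set of the space can have a
    nonmeasurable section. *)
Lemma borel_preimage_measurable d (X : measurableType d) m (f : X -> 'rV[R]_m)
    (A : set 'rV[R]_m) : <<s [set O : set 'rV[R]_m | open O] >> A ->
  (forall i, measurable_fun [set: X] (fun p : X => f p 0 i)) ->
  measurable (f @^-1` A).
Proof.
move=> bA mf.
apply: (bA [set A | measurable (f @^-1` A)]); split.
  split => [|B mB|F mF] /=.
  - by rewrite preimage_set0.
  - by rewrite setTD preimage_setC; exact: measurableC.
  - by rewrite preimage_bigcup; exact: bigcupT_measurable.
by move=> O oO /=; exact: open_preimage_measurable.
Qed.

(* Fubini for the indicator of N pulled back along (t, x) |-> x + t e_j: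
   integrating in x first gives +oo * mu N by translation invariance. *)
Lemma null_sections (j : 'I_n.+1) (N : set T) :
  <<s [set O : set T | open O] >> N ->
  (forall x, leb [set t | N (x + t *: delta_mx 0 j)] = 0%E) ->
  mu N = 0%E.
Proof.
move=> bN null.
pose s (p : measurableTypeR R * Rn) : T := (p.2 : T) + (p.1 : R) *: delta_mx 0 j.
have ms i : measurable_fun [set: measurableTypeR R * Rn] (fun p => s p 0 i).
  rewrite /s; under eq_fun do rewrite !mxE.
  apply: measurable_funD.
    exact: (measurableT_comp (measurable_coord i) measurable_snd).
  by apply: measurable_funM => //; exact: measurable_fst.
have mN : measurable (N : set Rn).
  exact: (@borel_preimage_measurable _ Rn _ idfun _ bN measurable_coord).
have msN : measurable (s @^-1` N) by exact: borel_preimage_measurable.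
pose f (p : measurableTypeR R * Rn) : \bar R := (\1_(s @^-1` N) p)%:E.
have mf : measurable_fun [set: measurableTypeR R * Rn] f.
  by apply/measurable_EFinP; exact: measurable_indic.
have f0 p : (0 <= f p)%E by rewrite lee_fin.
have := @fubini_tonelli _ _ _ _ R leb mu f mf f0.
have -> : (\int[leb]_t \int[mu]_x f (t, x) = \int[leb]_t mu N)%E.
  apply: eq_integral => t _.
  rewrite -(lebesgue_Rn_translate (t *: delta_mx 0 j) N).
  rewrite -[X in mu X]setIT -integral_indic//.
  exact: measurable_translate.
rewrite integral_cst//= (_ : leb setT = +oo%E); last first.
  by rewrite -set_itvNyy lebesgue_measure_itv.
rewrite [RHS]integral0_eq; last first.
  move=> x _; rewrite /f.
  rewrite -[RHS](null x) -[X in _ = leb X]setIT -integral_indic//.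
  apply: (@borel_preimage_measurable _ (measurableTypeR R) _
    (fun t : R => x + t *: delta_mx 0 j : T)) => // i.
  under eq_fun do rewrite !mxE.
  by apply: measurable_funD => //; exact: measurable_funM.
by move=> /eqP; rewrite mule_eq0 orbF => /eqP.
Qed.

End lebesgue_Rn_translation.

(** * Lipschitz functions of one variable are derivable almost everywhere *)

Section lipschitz_derivable_ae.
Context {R : realType}.
Local Notation leb := (@lebesgue_measure R).
Implicit Types (psi phi : R -> R) (x y : R).

Lemma cumulative_lebesgue_stieltjes_itv (psi : cumulative R R) x y : x <= y ->
  lebesgue_stieltjes_measure psi `]x, y]%classic = (psi y - psi x)%:E.
Proof.
move=> xy; rewrite /lebesgue_stieltjes_measure /measure_extension.
rewrite measurable_mu_extE/=; last exact: is_ocitv.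
by rewrite wlength_itv_bnd.
Qed.

(* The Stieltjes measures of psi and id - psi add up to the Lebesgue measure,
   so that of psi has a density. *)
Lemma nondecreasing_nonexpansive_stieltjes (psi : cumulative R R) :
  (forall x y, x <= y -> psi y - psi x <= y - x) ->
  lebesgue_stieltjes_measure psi `<< leb.
Proof.
move=> psi1.
have chi_nd : {homo (fun x => x - psi x) : x y / x <= y}.
  by move=> x y /psi1; lra.
have chi_rc : right_continuous (fun x => x - psi x).
  move=> x; apply: cvgB; last exact: cumulative_is_right_continuous.
  by apply: cvg_at_right_filter; exact: cvg_id.
pose chi : cumulative R R := HB.pack (fun x => x - psi x)
  (isCumulative.Build R _ R _ chi_nd chi_rc).
have E A : measurable A -> leb A = measure_add
    (lebesgue_stieltjes_measure psi) (lebesgue_stieltjes_measure chi) A.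
  apply: lebesgue_measure_unique => X /ocitvP[->|[[a b] /= ab ->]].
    by rewrite !measure0.
  transitivity (lebesgue_stieltjes_measure psi `]a, b]%classic +
    lebesgue_stieltjes_measure chi `]a, b]%classic)%E; last exact/esym/measure_addE.
  rewrite !cumulative_lebesgue_stieltjes_itv ?ltW//.
  rewrite lebesgue_measure_itv/= lte_fin ab -EFinB -EFinD.
  by congr EFin; rewrite /chi/=; lra.
apply/null_content_dominatesP => A mA A0.
have /eqP := esym (E _ mA); rewrite (A0 : leb A = 0%E) measure_addE.
by rewrite padde_eq0// => /andP[/eqP].
Qed.

(** The Stieltjes measure of [psi] has a density by Radon-Nikodym, so [psi] is locally a primitive
    of it, up to a constant, and is derivable at every Lebesgue point of the density. *)
Lemma nondecreasing_nonexpansive_ae_derivable psi :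
  (forall x y, x <= y -> 0 <= psi y - psi x <= y - x) ->
  {ae leb, forall x, derivable psi x 1}.
Proof.
move=> psi1.
have psi_nd : {homo psi : x y / x <= y}.
  by move=> x y /psi1/andP[]; rewrite subr_ge0.
have psi_rc : right_continuous psi.
  apply: right_continuousW => x; apply/cvgrPdist_le => /= e e0.
  near=> y; have : `|x - y| <= e.
    by near: y; apply: cvgr_dist_le => //; exact: cvg_id.
  apply: le_trans; have [xy|/ltW xy] := leP x y.
    by rewrite distrC [leRHS]distrC !ger0_norm ?subr_ge0 ?psi_nd//;
      have /andP[] := psi1 _ _ xy.
  by rewrite !ger0_norm ?subr_ge0 ?psi_nd//; have /andP[] := psi1 _ _ xy.
pose Psi : cumulative R R := HB.pack psi
  (isCumulative.Build R _ R _ psi_nd psi_rc).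
pose mu := lebesgue_stieltjes_measure Psi.
have mu_leb : mu `<< leb.
  by apply: nondecreasing_nonexpansive_stieltjes => x y /psi1/andP[].
(* On a bounded interval the Stieltjes measure is finite, which makes the density integrable;
   countably many intervals exhaust the line. *)
suff loc k : {ae leb, forall x, `](- k.+1%:R), k.+1%:R[%classic x -> derivable psi x 1}.
  have : {ae leb, forall x, forall k, `](- k.+1%:R), k.+1%:R[%classic x -> derivable psi x 1}.
    by apply: ae_foralln.
  apply: (filterS (Filter := ae_filter_ringOfSetsType leb)) => x /(_ (Num.bound `|x|)); apply.
  rewrite /= in_itv/= -ltr_norml (lt_trans (archi_boundP _))//.
  by rewrite ltr_nat.
set c : R := k.+1%:R.
pose I : set (measurableTypeR R) := `]- c, c]%classic.
have mI : measurable I by exact: measurable_itv.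
have c0 : - c <= c by rewrite /c; have := ler0n R k.+1; lra.
have Ifin : (mu I < +oo)%E.
  by rewrite /mu /I cumulative_lebesgue_stieltjes_itv// ltry.
have nu_leb : mfrestr mI Ifin `<< leb.
  apply/null_content_dominatesP => A mA A0; rewrite /mfrestr /mrestr.
  move/null_content_dominatesP : mu_leb; apply; first exact: measurableI.
  by apply: (@subset_measure0 _ _ _ _ _ A) => //; exact: measurableI.
have [f [f0 ffin intf nuE]] := radon_nikodym_sigma_finite nu_leb.
pose g := fine \o f.
have gE : EFin \o g = f by apply/funext => x; rewrite /g/= fineK.
have intg : leb.-integrable setT (EFin \o g) by rewrite gE.
have locg : locally_integrable setT g.
  by apply: open_integrable_locally => //; exact: openT.
have := lebesgue_differentiation locg.
apply: (filterS (Filter := ae_filter_ringOfSetsType leb)) => x gx.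
rewrite /= in_itv/= => /andP[cx xc].
pose F y := (\int[leb]_(t in [set` `](- c), y]]) (g t))%R.
have [dF _] : derivable F x 1 /\ F^`()%classic x = g x.
  apply: (@FTC1_lebesgue_pt _ g _ x c) => //.
  exact: integrableS intg.
(* The identity with the primitive is only available inside the interval; this suffices,
   derivability being local. *)
have FE y : `]- c, c[%classic y -> F y = psi y - psi (- c).
  rewrite /= in_itv/= => /andP[cy yc].
  rewrite /F /Rintegral; transitivity (fine (mfrestr mI Ifin `](- c)%R, y]%classic)).
    by rewrite nuE// -gE.
  rewrite /mfrestr /mrestr setIidl; last by apply: subset_itvl; exact: ltW.
  rewrite -[X in fine X]/(lebesgue_stieltjes_measure Psi `](- c)%R, y]%classic).
  by rewrite cumulative_lebesgue_stieltjes_itv//= ltW.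
have : derivable (F \+ cst (psi (- c))) x 1 by apply: derivableD.
apply: near_eq_derivable => //.
have : `]- c, c[%classic x by rewrite /= in_itv/= cx xc.
move=> /near_in_itvoo; apply: filterS => y /FE /= ->.
by rewrite subrK.
Unshelve. all: by end_near. Qed.

(** With [K] at least the Lipschitz constant and positive, the slopes of [K * x + phi x] lie between
    0 and [2 * K]; division by [2 * K] gives a nondecreasing nonexpansive function. *)
Lemma lipschitz_ae_derivable phi (L : R) :
  (forall x y, `|phi x - phi y| <= L * `|x - y|) ->
  {ae leb, forall x, derivable phi x 1}.
Proof.
move=> phiL; pose K := `|L| + 1.
have K0 : 0 < K by rewrite ltr_wpDl.
have phiK x y : x <= y -> - (K * (y - x)) <= phi y - phi x <= K * (y - x).
  move=> xy; rewrite -ler_norml (le_trans (phiL _ _))// ger0_norm ?subr_ge0//.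
  by rewrite ler_wpM2r ?subr_ge0// (le_trans (ler_norm _))// lerDl.
pose psi x := (2 * K)^-1 * (K * x + phi x).
have : {ae leb, forall x, derivable psi x 1}.
  apply: nondecreasing_nonexpansive_ae_derivable => x y xy.
  have /andP[h1 h2] := phiK _ _ xy.
  rewrite /psi -mulrBr mulr_ge0/= ?invr_ge0 ?mulr_ge0 ?(ltW K0)//; last by lra.
  by rewrite ler_pdivrMl ?mulr_gt0//; lra.
apply: (filterS (Filter := ae_filter_ringOfSetsType leb)) => x dpsi.
have -> : phi = ((2 * K) *: psi) \- (K *: (id : R -> R)).
  apply/funext => y; rewrite /psi/= !scalrfctE /=.
  rewrite /GRing.scale/= mulrA mulfV ?mul1r; first by rewrite addrC addKr.
  by rewrite mulf_neq0 ?gt_eqF.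
by apply: derivableB; apply: derivableZ => //; exact: derivable_id.
Qed.

End lipschitz_derivable_ae.

(** * Existence of partial derivatives almost everywhere *)

Section directional_derivative_ae.
Context {R : realType}.

Lemma norm_delta_mx_le m (j : 'I_m) : `|delta_mx 0 j : 'rV[R]_m| <= 1.
Proof.
rewrite [leLHS]/Num.norm/= mx_normrE.
apply/bigmax_leP; split => // -[i k] _ /=.
by rewrite mxE; case: (_ && _); rewrite ?normr1 ?normr0.
Qed.

Lemma lipschitz_continuous m (g : 'rV[R]_m -> R) (L : R) :
  (forall x y, `|g x - g y| <= L * `|x - y|) -> continuous g.
Proof.
move=> gL x; apply/(@cvgrPdist_le _ _ _ _ (nbhs_filter x)) => /= e e0.
pose K := `|L| + 1; have K0 : 0 < K by rewrite ltr_wpDl.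
near=> y; rewrite (le_trans (gL _ _))//.
apply: (@le_trans _ _ (K * `|x - y|)).
  by rewrite ler_wpM2r// (le_trans (ler_norm _))// lerDl.
rewrite mulrC -ler_pdivlMr//.
near: y; apply/nbhs_ballP; exists (e / K) => /=; first by rewrite divr_gt0.
by move=> y; rewrite -ball_normE/= => /ltW.
Unshelve. all: by end_near. Qed.

Lemma derivable_along_line m (g : 'rV[R]_m -> R) (v x : 'rV[R]_m) (t : R) :
  derivable (fun s : R => g (x + s *: v)) t 1 = derivable g (x + t *: v) v.
Proof.
rewrite /derivable; set f1 := (f in f @ _); set f2 := (f in _ = cvg (f @ _)).
suff -> : f1 = f2 by [].
apply/funext => h; rewrite /f1 /f2 /= [h *: 1]mulr1 scalerDl; congr (_ *: (g _ - _)).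
by rewrite addrCA.
Qed.

(** This is the Cauchy criterion for the difference quotient. It mentions no limit and its
    tolerances are indexed by integers, so that the set of derivability can be written with
    countable operations. *)
Lemma derivable_cauchyP m (g : 'rV[R]_m -> R) (v x : 'rV[R]_m) :
  let q h := h^-1 * (g (x + h *: v) - g x) in
  derivable g x v <-> forall a : nat, exists b : nat, forall h h',
    h != 0 -> h' != 0 -> `|h| < b.+1%:R^-1 -> `|h'| < b.+1%:R^-1 ->
    `|q h - q h'| <= a.+1%:R^-1.
Proof.
move=> q.
have -> : derivable g x v = cvg (q h @[h --> 0^']).
  rewrite /derivable; set f := (f in cvg (f @ _) = _).
  suff -> : f = q by [].
  by apply/funext => h; rewrite /f /q /= [h *: v + x]addrC.
split.
  move=> /cvg_ex[l ql] a.
  have /cvgrPdist_lt/(_ (a.+1%:R^-1 / 2)) := ql.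
  have a0 : 0 < a.+1%:R^-1 / 2 :> R by rewrite divr_gt0 ?invr_gt0.
  move=> /(_ a0) [/= e e0 eql].
  have [b be] : exists b : nat, b.+1%:R^-1 < e.
    by have [b _ bP] := near_infty_natSinv_lt (PosNum e0); exists b; apply: bP => /=.
  exists b => h h' h0 h'0 hb h'b.
  rewrite -(subrKA l) (le_trans (ler_normD _ _))// (splitr a.+1%:R^-1).
  rewrite lerD// ltW//; last by apply: eql => //=; rewrite sub0r normrN (lt_trans h'b).
  by rewrite distrC; apply: eql => //=; rewrite sub0r normrN (lt_trans hb).
move=> cq; apply/cauchy_cvgP/cauchy_exP => e e0.
have [a ae] : exists a : nat, a.+1%:R^-1 < e.
  by have [a _ aP] := near_infty_natSinv_lt (PosNum e0); exists a; apply: aP => /=.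
have [b bP] := cq a.
have b0 : 0 < b.+1%:R^-1 :> R by rewrite invr_gt0.
exists (q (b.+1%:R^-1 / 2)); exists b.+1%:R^-1 => //= h; rewrite /ball_/= sub0r normrN => hb h0.
rewrite /ball/= (le_lt_trans _ ae)// bP// ?gt_eqF ?divr_gt0//.
by rewrite gtr0_norm ?divr_gt0// ltr_pdivrMr// ltr_pMr// ltr1n.
Qed.

(** The negated Cauchy criterion is a countable union over [a] of countable intersections over [b]
    of the sets [O a b]. These are open by continuity of [g]: the uncountable quantifiers over [h]
    and [h'] only produce unions of open sets. *)
Lemma borel_not_derivable m (g : 'rV[R]_m -> R) (v : 'rV[R]_m) :
  continuous g -> <<s [set O : set 'rV[R]_m | open O] >> [set x | ~ derivable g x v].
Proof.
move=> cg.
pose q x h := h^-1 * (g (x + h *: v) - g x).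
pose small (b : nat) := [set h : R | h != 0 /\ `|h| < b.+1%:R^-1].
pose O (a b : nat) := \bigcup_(h in small b) \bigcup_(h' in small b)
  [set x | a.+1%:R^-1 < `|q x h - q x h'|].
have oO a b : open (O a b).
  apply: bigcup_open => h _; apply: bigcup_open => h' _.
  have cq k : continuous (fun x => q x k).
    rewrite /q => x; have Fx : Filter (nbhs x) := nbhs_filter x.
    apply: cvgM; first exact: cvg_cst.
    apply: cvgB; last exact: cg.
    apply: (cvg_comp (fun y => y + k *: v) g _ (cg _)).
    by apply: cvgD; [exact: cvg_id|exact: cvg_cst].
  have cqq : continuous (fun x => `|q x h - q x h'|).
    move=> x; have Fx : Filter (nbhs x) := nbhs_filter x.
    by apply: cvg_norm; apply: cvgB; exact: cq.
  have /continuousP/(_ _ (@open_gt R a.+1%:R^-1)) := cqq.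
  by congr open; apply/seteqP; split.
rewrite (_ : [set x | _] = \bigcup_a \bigcap_b O a b); last first.
  apply/seteqP; split => x /=.
    move=> /derivable_cauchyP /existsNP[a na]; exists a => // b _.
    apply: contrapT => nO; apply: na; exists b => h h' h0 h'0 hb h'b.
    rewrite leNgt; apply/negP => lt; apply: nO.
    by exists h; [split|exists h'; [split|]].
  move=> [a _ Oab] /derivable_cauchyP /(_ a)[b] bP.
  have [h [h0 hb] [h' [h'0 h'b]]] := Oab b I.
  by rewrite /= ltNge bP.
pose X := g_sigma_algebraType [set O : set 'rV[R]_m | open O].
apply: (@bigcupT_measurable _ X) => a; apply: (@bigcapT_measurable _ X) => b.
by apply: sub_sigma_algebra; exact: oO.
Qed.

(** The exceptional set is Borel, and by the one-dimensional theorem it meets every line parallel to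
    the axis in a null set. *)
Lemma lipschitz_ae_derivable_coord n (g : 'rV[R]_n.+1 -> R) (L : R) (j : 'I_n.+1) :
  (forall x y, `|g x - g y| <= L * `|x - y|) ->
  {ae @lebesgue_Rn R n, forall x, derivable g x (delta_mx 0 j)}.
Proof.
move=> gL; have cg := lipschitz_continuous gL.
have bN := @borel_not_derivable _ g (delta_mx 0 j) cg.
have mN : measurable ([set x | ~ derivable g x (delta_mx 0 j)] : set (measurableRn R n)).
  exact: (@borel_preimage_measurable _ _ (measurableRn R n) _ idfun _ bN measurable_coord).
exists [set x | ~ derivable g x (delta_mx 0 j)]; split => //.
apply: (null_sections bN) => x.
have mNx : measurable ([set t | ~ derivable g (x + t *: delta_mx 0 j) (delta_mx 0 j)]
    : set (measurableTypeR R)).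
  apply: (@borel_preimage_measurable _ _ (measurableTypeR R) _
    (fun t : R => x + t *: delta_mx 0 j) _ bN) => i.
  under eq_fun do rewrite !mxE.
  by apply: measurable_funD => //; exact: measurable_funM.
apply/(negligibleP _ mNx).
have : {ae @lebesgue_measure R,
    forall t, derivable (fun s : R => g (x + s *: delta_mx 0 j)) t 1}.
  apply: (@lipschitz_ae_derivable _ _ `|L|) => s t.
  rewrite (le_trans (gL _ _))// opprD addrACA subrr add0r -scalerBl normrZ.
  rewrite mulrA (le_trans (ler_norm _))// !normrM !normr_id.
  by rewrite ler_piMr// norm_delta_mx_le.
move=> [A [mA A0 sub]]; exists A; split=> [||t Nt]; [exact: mA|exact: A0|].
by apply: sub => dt; apply: Nt; rewrite -derivable_along_line.
Qed.

End directional_derivative_ae.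

(** * From an a.e. derivative bound to a bound on translation differences *)

Section translation_oscillation.
Context {R : realType} {n : nat}.
Local Notation T := 'rV[R]_n.+1.
Local Notation Rn := (measurableRn R n).
Local Notation mu := (@lebesgue_Rn R n).
Variables (w W : T -> R) (L : R) (j : 'I_n.+1) (h : R) (A B : set Rn).
Hypothesis wL : forall x y, `|w x - w y| <= L * `|x - y|.
Hypotheses (mB : measurable B) (B_fin : (mu B < +oo)%E).
Hypotheses (W0 : forall x, 0 <= W x) (mW : measurable_fun B (W : Rn -> R)).
Local Notation e := (delta_mx 0 j : T).
Hypothesis dw : {ae mu, forall x, B x -> `|'D_e w x| <= W x}.
Hypotheses (mA : measurable A) (h0 : 0 < h).
Hypothesis AB : forall (x : T) s, A x -> 0 <= s <= h -> B (x + s *: e).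

Let step (k : nat) : R := h / k.+1%:R.

Let step_gt0 k : 0 < step k. Proof. by rewrite divr_gt0. Qed.

(** This is [h] times the absolute difference quotient of increment [step k]. *)
Let f (k : nat) (x : T) : R := k.+1%:R * `|w (x + step k *: e) - w x|.

Let continuous_diff (s t : R) : continuous (fun x : T => `|w (x + s *: e) - w (x + t *: e)|).
Proof.
have cw := lipschitz_continuous wL.
move=> x; have Fx : Filter (nbhs x) := nbhs_filter x.
apply: cvg_norm; apply: cvgB.
  apply: (cvg_comp (fun y : T => y + s *: e) w _ (cw _)).
  by apply: cvgD; [exact: cvg_id|exact: cvg_cst].
apply: (cvg_comp (fun y : T => y + t *: e) w _ (cw _)).
by apply: cvgD; [exact: cvg_id|exact: cvg_cst].
Qed.

Let measurable_diff (s t : R) :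
  measurable_fun setT (fun x : Rn => `|w ((x : T) + s *: e) - w ((x : T) + t *: e)|).
Proof. exact: (continuous_measurable_Rn (@continuous_diff s t)). Qed.

Let measurable_diff0 (s : R) :
  measurable_fun setT (fun x : Rn => `|w ((x : T) + s *: e) - w x|).
Proof.
rewrite [X in measurable_fun _ X](_ : _ =
  fun x : Rn => `|w ((x : T) + s *: e) - w ((x : T) + 0 *: e)|)//.
by apply/funext => x; rewrite scale0r addr0.
Qed.

Let diff_le (x : T) k : `|w (x + step k *: e) - w x| <= `|L| * step k.
Proof.
rewrite (le_trans (wL _ _))// addrAC subrr add0r normrZ (gtr0_norm (step_gt0 _)).
rewrite (le_trans (ler_norm _))// normrM (ger0_norm (mulr_ge0 _ _))//; last exact: ltW.
by rewrite ler_wpM2l// ler_piMr ?norm_delta_mx_le// ltW.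
Qed.

(** The translation by [h] is cut into [k.+1] equal steps and the difference telescopes. The
    increment of index [i] over [A] is the first increment over a translate of [A], which [AB]
    places inside [B]; hence [k.+1] times one and the same integral. *)
Let integral_diff_le (k : nat) :
  (\int[mu]_(x in A) (`|w ((x : T) + h *: e)%R - w x|)%:E <= \int[mu]_(x in B) (f k x)%:E)%E.
Proof.
pose g i (x : T) := `|w (x + (i.+1%:R * step k) *: e) - w (x + (i%:R * step k) *: e)|.
have mg i : measurable_fun A (fun x : Rn => (g i x)%:E).
  by apply/measurable_EFinP; apply: measurable_funTS; exact: measurable_diff.
apply: (@le_trans _ _ (\int[mu]_(x in A) \sum_(i < k.+1) (g i x)%:E)%E).
  apply: (@ge0_le_integral _ _ _ mu _ mA).
  - by move=> x _; rewrite lee_fin normr_ge0.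
  - by apply/measurable_EFinP; apply: measurable_funTS; exact: measurable_diff0.
  - by apply: emeasurable_sum => i; exact: mg.
  move=> x _; rewrite sumEFin lee_fin.
  rewrite (_ : w (x + h *: e) - w x = \sum_(i < k.+1)
      (w ((x : T) + (i.+1%:R * step k) *: e) - w ((x : T) + (i%:R * step k) *: e))).
    exact: ler_norm_sum.
  rewrite -(big_mkord xpredT (fun i => w (x + (i.+1%:R * step k) *: e) -
    w (x + (i%:R * step k) *: e))) telescope_sumr//.
  by rewrite mul0r scale0r addr0 /step mulrC divfK.
rewrite (@ge0_integral_sum _ _ _ mu _ mA); last 2 first.
- by move=> i; exact: mg.
- by move=> i x _; rewrite lee_fin normr_ge0.
apply: (@le_trans _ _ (\sum_(i < k.+1) \int[mu]_(x in B)
    (`|w ((x : T) + step k *: e)%R - w x|)%:E)%E).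
  apply: lee_sum => i _.
  pose v : T := (i%:R * step k) *: e.
  pose Ai : set Rn := [set x : Rn | A ((x : T) - v)].
  have mAi : measurable Ai by exact: measurable_translate.
  have -> : (\int[mu]_(x in A) (g i x)%:E = \int[mu]_(x in Ai)
      (`|w ((x : T) + step k *: e)%R - w x|)%:E)%E.
    rewrite [RHS](@ge0_integral_translate _ _ v _ _ mAi); last 2 first.
    - by apply/measurable_EFinP; apply: measurable_funTS; exact: measurable_diff0.
    - by move=> x _; rewrite lee_fin normr_ge0.
    rewrite (_ : [set x : Rn | _] = A); last first.
      by apply/seteqP; split => x; rewrite /Ai /= addrK.
    apply: eq_integral => x _; rewrite /g /v.
    by rewrite -natr1 mulrDl mul1r scalerDl addrA.
  apply: (@ge0_subset_integral _ _ _ mu _ _ mAi mB).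
  - by apply/measurable_EFinP; apply: measurable_funTS; exact: measurable_diff0.
  - by move=> x _; rewrite lee_fin normr_ge0.
  move=> x Aix; have := @AB ((x : T) - v) (i%:R * step k) Aix.
  rewrite subrK; apply.
  rewrite mulr_ge0 ?(ltW (step_gt0 k))//= /step mulrA ler_pdivrMr// mulrC.
  by rewrite ler_wpM2l ?ler_nat ?(ltW h0)// ltnW.
rewrite -(@ge0_integral_sum _ _ _ mu _ mB); last 2 first.
- by move=> i; apply/measurable_EFinP; apply: measurable_funTS; exact: measurable_diff0.
- by move=> i x _; rewrite lee_fin normr_ge0.
apply: (@ge0_le_integral _ _ _ mu _ mB).
- by move=> x _; apply: sume_ge0 => i _; rewrite lee_fin.
- apply: emeasurable_sum => i; apply/measurable_EFinP; apply: measurable_funTS.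
  exact: measurable_diff0.
- apply/measurable_EFinP; apply: measurable_funTS; apply: measurable_funM => //;
  exact: measurable_diff0.
move=> x _; rewrite sumEFin lee_fin sumr_const card_ord.
by rewrite /f mulr_natl.
Qed.

(** Taking only the excess over [h * W] allows dominated convergence: it is at most a constant, by
    the Lipschitz bound, on a set of finite measure, whatever the integral of [W]. *)
Let rest (k : nat) (x : Rn) : R := Num.max 0 (f k x - h * W x).

Let cvg_rest : {ae mu, forall x, B x -> (rest k x)%:E @[k --> \oo] --> 0%E}.
Proof.
(* The bound [dw] could concern a default value of the derivative; a.e. derivability makes it the
   limit of the quotients. *)
have dw' := @lipschitz_ae_derivable_coord R n w L j wL.
have Fae : Filter (almost_everywhere mu) := ae_filter_ringOfSetsType mu.
apply: filterS2 dw dw' => x.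
move=> /[swap] dx /[apply] wx; apply: cvg_EFin => //=; first exact: nearW.
pose q t := t^-1 *: ((w \o shift x) (t *: e) - w x).
have qD : q t @[t --> 0^'] --> 'D_e w x by exact: dx.
have stepcvg : step k @[k --> \oo] --> 0^'.
  move=> P [/= eps eps0 epsP].
  have [k0 _ kP] := near_infty_natSinv_lt (PosNum (divr_gt0 eps0 h0)).
  exists k0 => // k /kP /= hk; apply: epsP; last by rewrite gt_eqF.
  rewrite /ball_/= sub0r normrN gtr0_norm// /step mulrC.
  by rewrite -ltr_pdivlMr.
apply/cvgrPdist_le => /= eps eps0.
have eps1 : 0 < eps / h by rewrite divr_gt0.
have /cvgrPdist_le/(_ _ eps1) := cvg_comp _ _ stepcvg qD.
apply: filterS => k /= hk.
rewrite sub0r normrN ger0_norm ?le_max ?lexx// ge_max (ltW eps0)/=.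
rewrite lerBlDl.
have -> : f k x = h * `|q (step k)|.
  rewrite /f /q /= normrZ normfV (gtr0_norm (step_gt0 k)) mulrA /step invf_div.
  by rewrite mulrCA divff ?gt_eqF// mulr1 [x + _]addrC.
apply: (@le_trans _ _ (h * (`|'D_e w x| + eps / h))).
  rewrite ler_wpM2l ?(ltW h0)// -lerBlDl (le_trans (lerB_dist _ _))//.
  by rewrite distrC.
by rewrite mulrDr [h * (_ / h)]mulrC divfK ?gt_eqF// lerD2r ler_wpM2l// ltW.
Qed.

Lemma integral_translate_diff_le :
  (\int[mu]_(x in A) (`|w ((x : T) + h *: e)%R - w x|)%:E <=
   h%:E * \int[mu]_(x in B) (W x)%:E)%E.
Proof.
have mf k : measurable_fun B (f k : Rn -> R).
  by apply: measurable_funTS; apply: measurable_funM => //; exact: measurable_diff0.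
have mrest k : measurable_fun B (rest k).
  apply: measurable_maxr; first exact: measurable_cst.
  apply: measurable_funB; first exact: mf.
  exact: measurable_funM (measurable_cst _) mW.
have bound k x : B x -> (`|(rest k x)%:E| <= (`|L| * h)%:E)%E.
  move=> _; rewrite lee_fin ger0_norm ?le_max ?lexx// ge_max mulr_ge0 ?(ltW h0)//=.
  rewrite lerBlDr (@le_trans _ _ (`|L| * h))// ?lerDl ?mulr_ge0 ?(ltW h0)//.
  rewrite /f -ler_pdivlMl// (le_trans (diff_le x k))// /step.
  by rewrite [leRHS]mulrCA [_^-1 * _]mulrC.
have icst : mu.-integrable B (cst (`|L| * h)%:E).
  apply/integrableP; split; first exact: measurable_cst.
  by rewrite integral_cst// lte_mul_pinfty// abse_ge0.
have [_ _ lim0] := @dominated_convergence _ _ _ mu B mB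
  (fun k x => (rest k x)%:E) (cst 0%E) _
  (fun k => proj2 (measurable_EFinP _ _) (mrest k)) (measurable_cst _)
  cvg_rest icst (aeW mu (fun x k => bound k x)).
rewrite integral0 in lim0.
have le k : (\int[mu]_(x in A) (`|w ((x : T) + h *: e)%R - w x|)%:E <=
   h%:E * \int[mu]_(x in B) (W x)%:E + \int[mu]_(x in B) (rest k x)%:E)%E.
  rewrite (le_trans (integral_diff_le k))//.
  rewrite -ge0_integralZl_EFin ?(ltW h0)//; last 2 first.
  - by move=> x _; rewrite lee_fin.
  - exact/measurable_EFinP.
  rewrite -(@ge0_integralD _ _ _ mu _ mB).
  - apply: (@ge0_le_integral _ _ _ mu _ mB).
    + by move=> x _; rewrite lee_fin mulr_ge0.
    + exact/measurable_EFinP.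
    + apply: emeasurable_funD; apply/measurable_EFinP; last exact: mrest.
      exact: measurable_funM (measurable_cst _) mW.
    move=> x _; rewrite lee_fin -lerBlDl le_max lexx orbT//.
  - by move=> x _; rewrite lee_fin mulr_ge0// ltW.
  - by apply/measurable_EFinP; exact: measurable_funM (measurable_cst _) mW.
  - by move=> x _; rewrite lee_fin le_max lexx.
  - exact/measurable_EFinP/mrest.
set Y := (h%:E * _)%E in le *.
(* [Y] may be infinite; the sum of the limits makes sense because the other one is finite. *)
have cvgY : (Y + \int[mu]_(x in B) (rest k x)%:E)%E @[k --> \oo] --> (Y + 0)%E.
  apply: cvgeD => //; [exact: fin_num_adde_defl|exact: cvg_cst].
rewrite -[Y]adde0 -(cvg_lim _ cvgY)//; apply: lime_ge; first exact: cvgP cvgY.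
exact: nearW.
Qed.

End translation_oscillation.

(** * The regularized logarithm of the modulus *)

Section logarithm_of_modulus.
Context {R : realType}.

(* AM-GM, summed over the coordinates, with weight c. *)
Lemma sum_mul_le_of_sum_sqr_le M (a d : 'I_M -> R) (c : R) : 0 <= c ->
  \sum_k d k ^+ 2 <= c ^+ 2 * \sum_k a k ^+ 2 ->
  `|\sum_k a k * d k| <= c * \sum_k a k ^+ 2.
Proof.
rewrite le_eqVlt => /predU1P[<-|c0] dca.
  have d0 k : d k = 0.
    apply/eqP; rewrite -sqrf_eq0.
    have : \sum_k d k ^+ 2 == 0.
      by rewrite eq_le (le_trans dca) ?expr0n ?mul0r//= sumr_ge0// => i _; exact: sqr_ge0.
    rewrite psumr_eq0 => [|i _]; last exact: sqr_ge0.
    by move=> /allP/(_ k); apply; rewrite mem_index_enum.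
  by rewrite mul0r big1 ?normr0// => k _; rewrite d0 mulr0.
rewrite (le_trans (ler_norm_sum _ _ _))//.
apply: (@le_trans _ _ (\sum_k (c / 2 * a k ^+ 2 + (2 * c)^-1 * d k ^+ 2))).
  apply: ler_sum => k _; set p := a k; set q := d k.
  have sq t : 0 <= t ^+ 2 / (2 * c) by rewrite divr_ge0 ?sqr_ge0 ?mulr_ge0 ?ltW.
  have cn0 : c != 0 by rewrite gt_eqF.
  have hm : c / 2 * p ^+ 2 + (2 * c)^-1 * q ^+ 2 - p * q = (c * p - q) ^+ 2 / (2 * c) by field.
  have hp : c / 2 * p ^+ 2 + (2 * c)^-1 * q ^+ 2 + p * q = (c * p + q) ^+ 2 / (2 * c) by field.
  have := sq (c * p - q); have := sq (c * p + q); rewrite -hm -hp ler_norml.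
  by move=> h1 h2; apply/andP; split; lra.
rewrite big_split/= -!mulr_sumr.
rewrite [leRHS](_ : _ = c / 2 * \sum_k a k ^+ 2 + (2 * c)^-1 * (c ^+ 2 * \sum_k a k ^+ 2)).
  by rewrite lerD2l ler_wpM2l// invr_ge0 mulr_ge0 ?ltW.
by move: (\sum_k a k ^+ 2) => S; field; rewrite gt_eqF.
Qed.

Lemma ln_sub_le (a b : R) : 0 < a -> 0 < b -> ln a - ln b <= (a - b) / b.
Proof.
move=> a0 b0; rewrite -ln_div ?posrE//.
have -> : a / b = 1 + (a - b) / b by field; rewrite gt_eqF.
apply: le_ln1Dx; rewrite ltr_pdivlMr//; lra.
Qed.

Lemma is_derive_along_line m (g : 'rV[R]_m -> R) (x v : 'rV[R]_m) (d : R) :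
  is_derive (0 : R) (1 : R) (fun t : R => g (x + t *: v)) d <-> is_derive x v g d.
Proof.
have E : (fun h : R => h^-1 *: (((fun t : R => g (x + t *: v)) \o shift 0) (h *: 1)
      - g (x + 0 *: v))) =
    (fun h : R => h^-1 *: ((g \o shift x) (h *: v) - g x)).
  apply/funext => h /=.
  by rewrite [h *: 1]mulr1 addr0 scale0r addr0 addrC [h *: v + x]addrC addrC.
by split => -[dg Dg]; split; move: dg Dg; rewrite /derivable /derive E.
Qed.

Definition log_modulus n M (eps : R) (v : 'rV[R]_n -> 'rV[R]_M) (x : 'rV[R]_n) : R :=
  2^-1 * ln (eps ^+ 2 + \sum_k v x 0 k ^+ 2).

Lemma log_modulus_arg_ge n M (eps : R) (v : 'rV[R]_n -> 'rV[R]_M) x :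
  eps ^+ 2 <= eps ^+ 2 + \sum_k v x 0 k ^+ 2.
Proof. by rewrite lerDl sumr_ge0// => k _; exact: sqr_ge0. Qed.

(** The logarithm is Lipschitz beyond [eps ^+ 2], and the squares are Lipschitz because [v] is
    bounded. The constant blows up as [eps] tends to 0, but it only serves for continuity,
    integrability and a.e. derivability; no later estimate contains it. *)
Lemma log_modulus_lipschitz n M (eps : R) (v : 'rV[R]_n -> 'rV[R]_M) (L b : R) :
  0 < eps -> (forall x k, `|v x 0 k| <= b) ->
  (forall x y k, `|v x 0 k - v y 0 k| <= L * `|x - y|) ->
  forall x y, `|log_modulus eps v x - log_modulus eps v y| <=
    M%:R * b * L / eps ^+ 2 * `|x - y|.
Proof.
move=> eps0 vb vL x y.
pose s z := eps ^+ 2 + \sum_k v z 0 k ^+ 2.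
have e2 : 0 < eps ^+ 2 by rewrite exprn_gt0.
have s0 z : eps ^+ 2 <= s z by exact: log_modulus_arg_ge.
have sL p q : `|s p - s q| <= M%:R * b * L * 2 * `|p - q|.
  rewrite /s opprD addrACA subrr add0r -sumrB (le_trans (ler_norm_sum _ _ _))//.
  apply: (@le_trans _ _ (\sum_(k < M) b * L * 2 * `|p - q|)); last first.
    by rewrite sumr_const card_ord -[leLHS]mulr_natl !mulrA.
  apply: ler_sum => k _; rewrite subr_sqr normrM mulrC.
  rewrite (_ : b * L * 2 * `|p - q| = (b + b) * (L * `|p - q|)); last by ring.
  by rewrite ler_pM// (le_trans (ler_normD _ _))// lerD.
have half p q : log_modulus eps v p - log_modulus eps v q <=
    M%:R * b * L / eps ^+ 2 * `|p - q|.
  rewrite /log_modulus -mulrBr -/(s p) -/(s q).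
  have sq0 := lt_le_trans e2 (s0 q).
  rewrite ler_pdivrMl// (le_trans (ln_sub_le (lt_le_trans e2 (s0 p)) sq0))//.
  rewrite ler_pdivrMr// (le_trans (ler_norm _))// (le_trans (sL _ _))//.
  set K := M%:R * b * L; have := le_trans (normr_ge0 _) (sL p q).
  rewrite -/K (_ : 2 * _ * _ = K * 2 * `|p - q| * (s q / eps ^+ 2)); last by ring.
  move=> K0; rewrite ler_peMr// ler_pdivlMr// mul1r; exact: s0.
by rewrite ler_norml lerNl opprB half andbT distrC half.
Qed.

Lemma is_derive_log_modulus n M (eps : R) (v : 'rV[R]_n -> 'rV[R]_M) x e :
  0 < eps -> (forall k, derivable (fun y => v y 0 k) x e) ->
  'D_e (log_modulus eps v) x = (\sum_k v x 0 k * 'D_e (fun y => v y 0 k) x) /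
    (eps ^+ 2 + \sum_k v x 0 k ^+ 2).
Proof.
move=> eps0 dv; set s' := \sum_k _.
pose s y := eps ^+ 2 + \sum_k v y 0 k ^+ 2.
have s0 : 0 < s x by exact: lt_le_trans (exprn_gt0 2 eps0) (log_modulus_arg_ge _ _ _).
have ds : is_derive x e s (2 * s').
  rewrite (_ : s = cst (eps ^+ 2) \+ \sum_k (fun y => v y 0 k) ^+ 2); last first.
    by apply/funext => y; rewrite /s /= fct_sumE.
  rewrite -[2 * s']add0r; apply: is_deriveD.
  rewrite mulr_sumr; apply: is_derive_sum => k.
  have := @is_deriveX _ _ _ 2 _ _ _ (derivableP (dv k)).
  by congr is_derive; rewrite /= expr1 mulrA.
have dln : is_derive x e (log_modulus eps v) (2^-1 *: ((s x)^-1 * (2 * s'))).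
  have -> : log_modulus eps v = 2^-1 *: (@ln R \o s) by [].
  apply: is_deriveZ; apply/is_derive_along_line.
  apply: (@is_derive1_comp _ (@ln R) (fun t => s (x + t *: e))).
    by rewrite scale0r addr0; exact: is_derive1_ln.
  exact/is_derive_along_line.
rewrite derive_val /GRing.scale/= -/(s x).
by field; rewrite gt_eqF.
Qed.

(** The numerator of the derivative is at most [c] times the squared modulus, the denominator at
    least the squared modulus; hence a bound free of [eps]. *)
Lemma log_modulus_derive_le n M (eps : R) (v : 'rV[R]_n -> 'rV[R]_M) x e (c : R) :
  0 < eps -> (forall k, derivable (fun y => v y 0 k) x e) -> 0 <= c ->
  \sum_k ('D_e (fun y => v y 0 k) x) ^+ 2 <= c ^+ 2 * \sum_k v x 0 k ^+ 2 ->
  `|'D_e (log_modulus eps v) x| <= c.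
Proof.
move=> eps0 dv c0 dc; rewrite is_derive_log_modulus// normrM normfV.
have s0 : 0 < eps ^+ 2 + \sum_k v x 0 k ^+ 2.
  exact: lt_le_trans (exprn_gt0 2 eps0) (log_modulus_arg_ge _ _ _).
rewrite (gtr0_norm s0) ler_pdivrMr// (le_trans (sum_mul_le_of_sum_sqr_le c0 dc))//.
by rewrite ler_wpM2l// lerDr sqr_ge0.
Qed.

End logarithm_of_modulus.

(** * Comparison of means over a cube and over the cube of half the side *)

Section mean_oscillation.
Context {R : realType} {n : nat}.
Local Notation T := 'rV[R]_n.+1.
Local Notation Rn := (measurableRn R n).
Local Notation mu := (@lebesgue_Rn R n).
Local Notation e j := (delta_mx 0 j : T).

Lemma lipschitz_integrable_box (w : T -> R) (L : R) (ab : T * T) :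
  (forall x y, `|w x - w y| <= L * `|x - y|) ->
  mu.-integrable (box ab) (EFin \o (w : Rn -> R)).
Proof.
move=> wL; apply: measurable_bounded_integrable.
- exact: measurable_box.
- exact: lebesgue_Rn_box_lty.
- exact/measurable_funTS/(continuous_measurable_Rn (lipschitz_continuous wL)).
exists (`|w ab.1| + `|L| * `|ab.2 - ab.1|); split => // r /ltW rb x abx.
apply: le_trans rb; rewrite -[w x](subrK (w ab.1)) addrC (le_trans (ler_normD _ _))//.
rewrite lerD2l (le_trans (wL _ _))// (le_trans (ler_norm _))// normrM normr_id.
rewrite ler_wpM2l// [leLHS]/Num.norm/= mx_normrE.
apply/bigmax_leP; split => // -[i k] _ /=; rewrite (ord1 i).
rewrite (le_trans _ (norm_coord_le _ k))// !mxE.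
have /andP[h1 h2] := abx k.
by rewrite !ger0_norm; lra.
Qed.

(** An integrated form of the bound of the gradient of [w] by [W] on [Q]; it is the only trace of
    the differential inequality in the estimates of means. *)
Definition oscillation_bound (Q : set Rn) (W w : T -> R) := forall j h (A B : set Rn),
  0 < h -> measurable A -> measurable B -> B `<=` Q ->
  (forall (x : T) s, A x -> 0 <= s <= h -> B (x + s *: e j)) ->
  (\int[mu]_(x in A) (`|w ((x : T) + h *: e j)%R - w x|)%:E <=
   h%:E * \int[mu]_(x in B) (W x)%:E)%E.

Variables (Q : set Rn) (W : T -> R).
Hypotheses (mQ : measurable Q) (W0 : forall x, 0 <= W x).
Hypothesis iW : mu.-integrable Q (EFin \o (W : Rn -> R)).
Hypothesis iWn : mu.-integrable Q (EFin \o ((fun x => W x ^+ n.+1) : Rn -> R)).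

Lemma Rintegral_box_translate_le (w : T -> R) (L : R) j h (ab : T * T) (B : set Rn) :
  (forall x y, `|w x - w y| <= L * `|x - y|) -> oscillation_bound Q W w ->
  0 < h -> measurable B -> B `<=` Q ->
  (forall (x : T) s, box ab x -> 0 <= s <= h -> B (x + s *: e j)) ->
  `|\int[mu]_(x in box ab) w ((x : T) + h *: e j) - \int[mu]_(x in box ab) w x| <=
  h * \int[mu]_(x in B) W x.
Proof.
move=> wL wosc h0 mB BQ AB.
have mab := measurable_box ab.
pose w' (x : T) := w (x + h *: e j).
have w'L x y : `|w' x - w' y| <= L * `|x - y|.
  by rewrite (le_trans (wL _ _))// opprD addrACA subrr addr0.
have iw := lipschitz_integrable_box ab wL.
have iw' := lipschitz_integrable_box ab w'L.
rewrite -RintegralB// (le_trans (le_normr_Rintegral _ _))//.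
  by have := integrableB mab iw' iw; apply: eq_integrable.
have iWB := integrableS mQ mB BQ iW.
rewrite -lee_fin EFinM /Rintegral !fineK; last 2 first.
- exact: integrable_fin_num iWB.
- apply: integrable_fin_num => //.
  by have := integrable_norm (integrableB mab iw' iw); apply: eq_integrable.
exact: wosc.
Qed.

Definition halve_coord (j : 'I_n.+1) (b : T) : T :=
  \row_i if i == j then b 0 i / 2 else b 0 i.

(** The box is the disjoint union of its lower half and of the translate of that half by half an
    edge, and the translation changes the integral by a controlled amount. *)
Lemma Rintegral_halve_le (w : T -> R) (L : R) j (z b : T) :
  (forall x y, `|w x - w y| <= L * `|x - y|) -> oscillation_bound Q W w ->
  (forall i, 0 < b 0 i) -> box (z, z + b) `<=` Q ->
  `|\int[mu]_(x in box (z, z + b)) w x -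
    2 * \int[mu]_(x in box (z, z + halve_coord j b)) w x| <=
  b 0 j / 2 * \int[mu]_(x in box (z, z + b)) W x.
Proof.
move=> wL wosc b0 bQ; set A := box (z, z + halve_coord j b).
pose h := b 0 j / 2; have h0 : 0 < h by rewrite divr_gt0.
pose v : T := h *: e j.
pose S : set Rn := [set x : Rn | (A : set Rn) ((x : T) - v)].
have mA : measurable (A : set Rn) by exact: measurable_box.
have mS : measurable S by exact: measurable_translate.
have vE i : v 0 i = if i == j then h else 0.
  by rewrite /v !mxE eqxx/=; case: eqP => _; rewrite ?mulr1 ?mulr0.
have AS : box (z, z + b) = A `|` S.
  apply/seteqP; split => x.
    move=> bx; have [xj|xj] := leP (x 0 j) (z 0 j + h).
      left => i; have := bx i; rewrite !mxE/=.
      by case: eqP => [->|//] /andP[-> _].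
    right => i; have := bx i; rewrite !mxE/= ?eqxx/=.
    case: eqP => [->|_]; last by rewrite mulr0 subr0.
    by rewrite mulr1 => /andP[_ xb]; rewrite /h in xj *; apply/andP; split; lra.
  move=> [] Ax i; have := Ax i; have := b0 i; rewrite !mxE/=.
    by case: eqP => // _; lra.
  rewrite ?eqxx/=; case: eqP => [->|_]; last by rewrite mulr0 subr0.
  by rewrite mulr1 /h => bj /andP[h1 h2]; apply/andP; split; lra.
have dAS : [disjoint A & S].
  apply/disj_setPS => x [Ax Sx]; have := Ax j; have := Sx j.
  by rewrite !mxE !eqxx/= mulr1 /h; lra.
have ibox := lipschitz_integrable_box (z, z + b) wL.
rewrite AS Rintegral_setU//; last by rewrite -AS.
have -> : \int[mu]_(x in S) w x = \int[mu]_(x in A) w ((x : T) + v).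
  rewrite (@Rintegral_translate _ _ v)//; last first.
    exact: (continuous_measurable_Rn (lipschitz_continuous wL)).
  by congr (Rintegral _ _ _); apply/seteqP; split => x; rewrite /S /= addrK.
rewrite mulr_natl mulr2n opprD addrACA subrr add0r -AS.
apply: (Rintegral_box_translate_le wL wosc) => //; first exact: measurable_box.
move=> x s Ax /andP[s0 sh] i; have := Ax i; rewrite !mxE ?eqxx/=.
case: eqP => [->|_]; last by rewrite mulr0 addr0.
by rewrite mulr1; move: sh s0; rewrite /h; lra.
Qed.

(** [z] is a corner, and lies outside the cube when [s] is positive: the cubes at [z] of sides
    [s / 2 ^+ k] have empty intersection. *)
Definition cube (z : T) (s : R) : set T := box (z, z + const_mx s).

Lemma cubeP z s x : cube z s x <-> forall i, z 0 i < x 0 i <= z 0 i + s.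
Proof. by split=> h i; have := h i; rewrite !mxE. Qed.

Lemma cubeS z s t : s <= t -> cube z s `<=` cube z t.
Proof.
move=> st x /cubeP xs; apply/cubeP => i; have /andP[-> h] := xs i.
by rewrite (le_trans h)// lerD2l.
Qed.

Lemma measurable_cube z s : measurable (cube z s : set Rn).
Proof. exact: measurable_box. Qed.

Lemma lebesgue_Rn_cube z s : 0 <= s -> fine (mu (cube z s)) = s ^+ n.+1.
Proof.
move=> s0; rewrite /cube lebesgue_Rn_box/= /box_volume/=.
rewrite (eq_bigr (fun=> s)) ?prodr_const ?card_ord// => i _.
by rewrite !mxE addrAC subrr add0r (max_idPr s0).
Qed.

Lemma Rintegral_cube_halve_le (w : T -> R) (L : R) (z : T) (s : R) :
  (forall x y, `|w x - w y| <= L * `|x - y|) -> oscillation_bound Q W w ->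
  0 < s -> cube z s `<=` Q ->
  `|\int[mu]_(x in cube z s) w x - 2 ^+ n.+1 * \int[mu]_(x in cube z (s / 2)) w x| <=
  2 ^+ n.+1 * (s * \int[mu]_(x in cube z s) W x).
Proof.
move=> wL wosc s0 sQ.
pose b (m : nat) : T := \row_i if (i < m)%N then s / 2 else s.
have b0 m i : 0 < b m 0 i <= s.
  by rewrite mxE; case: ifP => _; lra.
have bS m : box (z, z + b m) `<=` cube z s.
  move=> x xb; apply/cubeP => i; have := xb i; have := b0 m i; rewrite !mxE/=.
  by case: ifP => _; lra.
have iWs := integrableS mQ (measurable_cube z s) sQ iW.
set I := \int[mu]_(x in cube z s) W x.
have I0 : 0 <= I by apply: Rintegral_ge0 => x _.
(* The edges are halved one coordinate at a time. Halving the coordinate [m] costs at most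
   [s / 2 * I], multiplied by the factor [2 ^+ m] already present, whence a geometric sum. *)
have step m : (m <= n.+1)%N ->
  `|\int[mu]_(x in cube z s) w x - 2 ^+ m * \int[mu]_(x in box (z, z + b m)) w x| <=
  (2 ^+ m - 1) * (s / 2 * I).
  elim: m => [_|m IH mn].
    rewrite (_ : box (z, z + b 0%N) = cube z s); last first.
      by congr box; congr pair; congr (_ + _); apply/rowP => i; rewrite !mxE.
    by rewrite expr0 mul1r !subrr normr0 mul0r.
  have bE : b m.+1 = halve_coord (Ordinal mn) (b m).
    apply/rowP => i; rewrite !mxE ltnS leq_eqVlt -val_eqE/=.
    by case: eqP => [->|]//=; rewrite ltnn.
  have := @Rintegral_halve_le w L (Ordinal mn) z (b m) wL wosc.
  move=> /(_ (fun i => proj1 (andP (b0 m i))) (subset_trans (bS m) sQ)).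
  rewrite -bE [b m 0 _]mxE/= ltnn.
  have : \int[mu]_(x in box (z, z + b m)) W x <= I.
    rewrite /I /Rintegral fine_le//.
    - apply: (integrable_fin_num (measurable_box _)).
      exact: (integrableS (measurable_cube z s) (measurable_box _) (bS m) iWs).
    - exact: (integrable_fin_num (measurable_cube z s) iWs).
    - apply: ge0_subset_integral => //; [exact: measurable_box|exact: measurable_box| |].
        by have /integrableP[] := iWs.
      by move=> x _; rewrite lee_fin.
  move: (IH (ltnW mn)); rewrite exprS.
  set p := 2 ^+ m : R; have p0 : 0 < p by rewrite exprn_gt0.
  move: (\int[mu]_(x in cube z s) w x) (\int[mu]_(x in box (z, z + b m)) w x)
    (\int[mu]_(x in box (z, z + b m.+1)) w x) (\int[mu]_(x in box (z, z + b m)) W x).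
  move=> J Jm Jm1 Im h1 ImI h2.
  rewrite -(subrKA (p * Jm)) (le_trans (ler_normD _ _))//.
  have -> : (2 * p - 1) * (s / 2 * I) = (p - 1) * (s / 2 * I) + p * (s / 2 * I) by ring.
  rewrite lerD// (_ : p * Jm - 2 * p * Jm1 = p * (Jm - 2 * Jm1)); last by ring.
  rewrite normrM (gtr0_norm p0) ler_pM2l//.
  by rewrite (le_trans h2)// ler_wpM2l// divr_ge0// ltW.
have := step n.+1 (leqnn _).
rewrite (_ : box (z, z + b n.+1) = cube z (s / 2)); last first.
  by congr box; congr pair; congr (_ + _); apply/rowP => i; rewrite !mxE ltn_ord.
move=> /le_trans; apply.
have p0 : 0 < 2 ^+ n.+1 :> R by rewrite exprn_gt0.
apply: (@le_trans _ _ (2 ^+ n.+1 * (s / 2 * I))).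
  by apply: ler_wpM2r; [rewrite mulr_ge0// divr_ge0// ltW|lra].
by rewrite ler_pM2l// ler_wpM2r//; lra.
Qed.

(** Either [a <= d], or the quotient alone exceeds [a]. This takes the place of Hoelder's
    inequality: [d] is fixed small, then the cube is shrunk until the integral of the power is
    negligible. *)
Lemma young_le (a d : R) : 0 <= a -> 0 < d -> a <= d + a ^+ n.+1 / d ^+ n.
Proof.
move=> a0 d0; have [ad|/ltW da] := leP a d.
  by rewrite (le_trans ad)// lerDl divr_ge0// exprn_ge0// ltW.
rewrite (@le_trans _ _ (a ^+ n.+1 / d ^+ n))//; last by rewrite lerDr ltW.
rewrite ler_pdivlMr ?exprn_gt0// exprS ler_wpM2l//.
by rewrite lerXn2r ?nnegrE ?(ltW d0).
Qed.

Definition mean (w : T -> R) (z : T) (s : R) : R :=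
  (\int[mu]_(x in cube z s) w x) / s ^+ n.+1.

(** [young_le] is applied to [s * W x]. Since the exponent is the dimension, the factor [s ^+ n.+1]
    of the power cancels the volume of the cube, and the bound depends on [s] only through the
    domain of integration. *)
Lemma mean_halve_le (w : T -> R) (L : R) (z : T) (s d : R) :
  (forall x y, `|w x - w y| <= L * `|x - y|) -> oscillation_bound Q W w ->
  0 < s -> 0 < d -> cube z s `<=` Q ->
  `|mean w z s - mean w z (s / 2)| <=
  2 ^+ n.+1 * (d + (\int[mu]_(x in cube z s) (W x ^+ n.+1)) / d ^+ n).
Proof.
move=> wL wosc s0 d0 sQ.
have sn0 : 0 < s ^+ n.+1 by rewrite exprn_gt0.
have mc := measurable_cube z s.
have iWs := integrableS mQ mc sQ iW.
have iWns := integrableS mQ mc sQ iWn.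
rewrite -(ler_pM2l sn0) -[X in X * `|_|](gtr0_norm sn0) -normrM mulrBr /mean.
rewrite [s ^+ n.+1 * (_ / _)]mulrC divfK ?gt_eqF//.
have -> : s ^+ n.+1 * ((\int[mu]_(x in cube z (s / 2)) w x) / (s / 2) ^+ n.+1) =
    2 ^+ n.+1 * \int[mu]_(x in cube z (s / 2)) w x.
  by rewrite expr_div_n invf_div; field; rewrite gt_eqF.
rewrite (le_trans (Rintegral_cube_halve_le wL wosc s0 sQ))// [leRHS]mulrCA.
rewrite ler_pM2l ?exprn_gt0//.
have icst (k : R) : mu.-integrable (cube z s) (EFin \o cst k).
  apply: (@lipschitz_integrable_box (cst k) 0) => x y.
  by rewrite subrr normr0 mul0r.
have iZ : mu.-integrable (cube z s)
    (EFin \o (fun x => (s ^+ n.+1 / d ^+ n) * W x ^+ n.+1)).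
  by have := integrableZl mc (s ^+ n.+1 / d ^+ n) iWns; apply: eq_integrable.
rewrite -RintegralZl//.
have -> : s ^+ n.+1 * (d + (\int[mu]_(x in cube z s) (W x ^+ n.+1)) / d ^+ n) =
    \int[mu]_(x in cube z s) (d + (s ^+ n.+1 / d ^+ n) * W x ^+ n.+1).
  rewrite [RHS]RintegralD//; last exact: icst.
  rewrite [X in _ = _ + X](RintegralZl (s ^+ n.+1 / d ^+ n) mc iWns).
  rewrite Rintegral_cst// lebesgue_Rn_cube ?(ltW s0)//.
  by ring.
apply: le_Rintegral => //.
- by have := integrableZl mc s iWs; apply: eq_integrable.
- by have := integrableD mc (icst d) iZ; apply: eq_integrable.
move=> x _; rewrite (le_trans (young_le (mulr_ge0 (ltW s0) (W0 x)) d0))// exprMn.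
by rewrite lerD2l mulrAC.
Qed.

End mean_oscillation.

(** * Drift of the means and propagation of zeros along an axis *)

Section zero_propagation.
Context {R : realType} {n : nat}.
Local Notation T := 'rV[R]_n.+1.
Local Notation Rn := (measurableRn R n).
Local Notation mu := (@lebesgue_Rn R n).
Local Notation e j := (delta_mx 0 j : T).
Variables (Q : set Rn) (W : T -> R).
Hypotheses (mQ : measurable Q) (W0 : forall x, 0 <= W x).
Hypothesis iW : mu.-integrable Q (EFin \o (W : Rn -> R)).
Hypothesis iWn : mu.-integrable Q (EFin \o ((fun x => W x ^+ n.+1) : Rn -> R)).

Lemma dyadic_small (s r : R) : 0 < r -> exists k0, forall k, (k0 <= k)%N -> s / 2 ^+ k < r.
Proof.
move=> r0; have : 0 <= `|s| / r by rewrite divr_ge0// ltW.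
move=> /archi_boundP; set k0 := Num.bound _ => k0P; exists k0 => k kk0.
rewrite ltr_pdivrMr ?exprn_gt0// (le_lt_trans (ler_norm _))//.
rewrite mulrC -ltr_pdivrMr// (lt_le_trans k0P)//.
rewrite (@le_trans _ _ k%:R) ?ler_nat//.
by rewrite -natrX ler_nat ltnW// ltn_expl.
Qed.

(** By dominated convergence: a point of the cube has first coordinate larger than that of [z], so
    it leaves the small cubes eventually. *)
Lemma Rintegral_cube_cvg0 (z : T) (s : R) : cube z s `<=` Q -> 0 < s ->
  (\int[mu]_(x in cube z (s / 2 ^+ k)) (W x ^+ n.+1)) @[k --> \oo] --> (0 : R).
Proof.
move=> sQ s0; have mc := measurable_cube z s.
have iWs := integrableS mQ mc sQ iWn.
pose g (x : Rn) := W x ^+ n.+1.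
pose f (k : nat) (x : Rn) := (g x * \1_(cube z (s / 2 ^+ k) : set Rn) x)%:E.
have mf k : measurable_fun (cube z s : set Rn) (f k).
  apply/measurable_EFinP; apply: measurable_funM.
    by have /integrableP[/measurable_EFinP] := iWs.
  by apply: measurable_indic; exact: measurable_cube.
have f0 : {ae mu, forall x : Rn, (cube z s : set Rn) x ->
    f k x @[k --> \oo] --> (cst 0%E : Rn -> \bar R) x}.
  apply: aeW => x /cubeP xz; apply: cvg_near_cst.
  have /andP[z0 _] := xz ord0.
  have [k0 k0P] := @dyadic_small s (x 0 ord0 - z 0 ord0) (ltac:(by rewrite subr_gt0)).
  exists k0 => // k /= /k0P hk; rewrite /f indicE memNset ?mulr0//.
  move=> /cubeP/(_ ord0)/andP[_]; lra.
have fle : {ae mu, forall (x : Rn) k, (cube z s : set Rn) x -> (`|f k x| <= (g x)%:E)%E}.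
  apply: aeW => x k _; rewrite lee_fin normrM ger0_norm ?exprn_ge0//.
  by rewrite ler_piMr ?exprn_ge0// indicE; case: (_ \in _); rewrite ?normr1 ?normr0.
have [_ _ lim0] := dominated_convergence mc mf (measurable_cst _) f0 iWs fle.
rewrite integral0 in lim0.
have E k : \int[mu]_(x in cube z (s / 2 ^+ k)) (W x ^+ n.+1) =
    fine (\int[mu]_(x in cube z s) f k x)%E.
  have sub : cube z (s / 2 ^+ k) `<=` cube z s.
    apply: cubeS; rewrite ler_pdivrMr ?exprn_gt0//.
    by rewrite ler_peMr ?(ltW s0)// exprn_ege1// ler1n.
  rewrite -[X in Rintegral _ X](setIidr sub) /Rintegral; congr fine.
  rewrite integral_mkcondr; apply: eq_integral => x _.
  by rewrite patchE /f indicE; case: (x \in _); rewrite ?mulr1 ?mulr0.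
rewrite (eq_cvg _ _ E).
by apply: fine_cvg; exact: lim0.
Qed.

(** All but finitely many halvings change the mean by at most [eta], and [C] pays for the others.
    [C] comes from [W] alone and is chosen before [w], so it serves for every [eps] at once. *)
Lemma mean_drift (z : T) (s eta : R) : 0 < s -> 0 < eta -> cube z s `<=` Q ->
  exists C, forall (w : T -> R) (L : R),
    (forall x y, `|w x - w y| <= L * `|x - y|) -> oscillation_bound Q W w ->
    forall k, `|mean w z s - mean w z (s / 2 ^+ k)| <= C + eta * k%:R.
Proof.
move=> s0 eta0 sQ.
have t0 : 0 < 2 ^+ n.+1 :> R by rewrite exprn_gt0.
(* Chosen so that the term [2 ^+ n.+1 * d] of [a k] is half of [eta]; the other half is for the
   integral [P k], which tends to 0. *)
pose d := eta / 2 / 2 ^+ n.+1; have d0 : 0 < d by rewrite !divr_gt0.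
pose P k := \int[mu]_(x in cube z (s / 2 ^+ k)) (W x ^+ n.+1).
pose a k := 2 ^+ n.+1 * (d + P k / d ^+ n).
have P0 k : 0 <= P k by apply: Rintegral_ge0 => x _; rewrite exprn_ge0.
have dn0 : 0 < d ^+ n by rewrite exprn_gt0.
have a0 k : 0 <= a k.
  by rewrite /a mulr_ge0 ?(ltW t0)// addr_ge0 ?(ltW d0)// divr_ge0 ?(ltW dn0).
have sk k : 0 < s / 2 ^+ k by rewrite divr_gt0 ?exprn_gt0.
have skQ k : cube z (s / 2 ^+ k) `<=` Q.
  apply: subset_trans sQ; apply: cubeS; rewrite ler_pdivrMr ?exprn_gt0//.
  by rewrite ler_peMr ?(ltW s0)// exprn_ege1// ler1n.
have [k0 _ k0P] : \forall k \near \oo, a k <= eta.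
  have r0 : 0 < eta / 2 / 2 ^+ n.+1 * d ^+ n by rewrite mulr_gt0.
  have /cvgrPdist_le/(_ _ r0) := Rintegral_cube_cvg0 sQ s0.
  apply: filterS => k; rewrite sub0r normrN ger0_norm ?P0// -/(P k) => Pk.
  have : P k / d ^+ n <= eta / 2 / 2 ^+ n.+1 by rewrite ler_pdivrMr.
  rewrite -(ler_pM2l t0) /a mulrDr => h; rewrite [leRHS]splitr lerD//.
    by rewrite /d mulrC divfK ?gt_eqF.
  by rewrite (le_trans h)// mulrC divfK ?gt_eqF.
exists (\sum_(i < k0) a i) => w L wL wosc.
have bound k : `|mean w z s - mean w z (s / 2 ^+ k)| <= \sum_(i < k) a i.
  elim: k => [|k IH].
    by rewrite expr0 divr1 subrr normr0 big_ord0.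
  rewrite big_ord_recr/= -(subrKA (mean w z (s / 2 ^+ k))).
  rewrite (le_trans (ler_normD _ _))// lerD//.
  rewrite [2 ^+ k.+1]exprSr invfM mulrA.
  exact: (mean_halve_le mQ W0 iW iWn wL wosc (sk k) d0 (skQ k)).
move=> k; rewrite (le_trans (bound k))//.
have [kk0|k0k] := leqP k k0.
  rewrite -[leLHS]addr0 lerD ?mulr_ge0 ?(ltW eta0)//.
  rewrite -(subnKC kk0) big_split_ord/= lerDl; exact: sumr_ge0.
rewrite -(subnKC (ltnW k0k)) big_split_ord/= lerD2l.
apply: (@le_trans _ _ (\sum_(i < k - k0) eta)).
  by apply: ler_sum => i _; apply: k0P => /=; rewrite leq_addr.
rewrite sumr_const card_ord -[eta *+ _]mulr_natr ler_wpM2l ?(ltW eta0)//.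
by rewrite ler_nat leq_addl.
Qed.

Lemma mean_le (w : T -> R) (L c : R) (z : T) (s : R) :
  (forall x y, `|w x - w y| <= L * `|x - y|) -> 0 < s ->
  (forall x, cube z s x -> w x <= c) -> mean w z s <= c.
Proof.
move=> wL s0 wc; rewrite /mean ler_pdivrMr ?exprn_gt0//.
rewrite -(lebesgue_Rn_cube z (ltW s0)) -Rintegral_cst; last exact: measurable_cube.
apply: le_Rintegral => //; first exact: measurable_cube.
  exact: lipschitz_integrable_box wL.
apply: (@lipschitz_integrable_box _ _ (cst c) 0) => x y.
by rewrite subrr normr0 mul0r.
Qed.

Lemma mean_ge (w : T -> R) (L c : R) (z : T) (s : R) :
  (forall x y, `|w x - w y| <= L * `|x - y|) -> 0 < s ->
  (forall x, cube z s x -> c <= w x) -> c <= mean w z s.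
Proof.
move=> wL s0 wc; rewrite /mean ler_pdivlMr ?exprn_gt0//.
rewrite -(lebesgue_Rn_cube z (ltW s0)) -Rintegral_cst; last exact: measurable_cube.
apply: le_Rintegral => //; first exact: measurable_cube.
  apply: (@lipschitz_integrable_box _ _ (cst c) 0) => x y.
  by rewrite subrr normr0 mul0r.
exact: lipschitz_integrable_box wL.
Qed.

Lemma mean_translate_le (w : T -> R) (L : R) j (z : T) (s t : R) :
  (forall x y, `|w x - w y| <= L * `|x - y|) -> oscillation_bound Q W w ->
  0 < s -> 0 < t ->
  (forall (x : T) r, cube z s x -> 0 <= r <= t -> Q (x + r *: e j)) ->
  `|mean w (z + t *: e j) s - mean w z s| <= t * (\int[mu]_(x in Q) W x) / s ^+ n.+1.
Proof.
move=> wL wosc s0 t0 zQ; have sn0 : 0 < s ^+ n.+1 by rewrite exprn_gt0.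
rewrite /mean -mulrBl normrM normfV (gtr0_norm sn0) ler_pM2r ?invr_gt0//.
have -> : \int[mu]_(x in cube (z + t *: e j) s) w x =
    \int[mu]_(x in cube z s) w ((x : T) + t *: e j).
  rewrite (@Rintegral_translate _ _ (t *: e j)).
  - congr (Rintegral _ _ _); apply/seteqP; split => x /=.
      by move=> /cubeP h; apply/cubeP => i; have := h i; rewrite !mxE; lra.
    by move=> /cubeP h; apply/cubeP => i; have := h i; rewrite !mxE; lra.
  - exact: measurable_cube.
  exact: (continuous_measurable_Rn (lipschitz_continuous wL)).
exact: (Rintegral_box_translate_le mQ iW wL wosc t0 mQ).
Qed.

Variables (M : nat) (v : T -> 'rV[R]_M) (L b : R).
Hypothesis vb : forall x k, `|v x 0 k| <= b.
Hypothesis vL : forall x y k, `|v x 0 k - v y 0 k| <= L * `|x - y|.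
Hypothesis vosc : forall eps, 0 < eps -> oscillation_bound Q W (log_modulus eps v).

Lemma cube_dist_le (z x : T) s : 0 <= s -> cube z s x -> `|x - z| <= s.
Proof.
move=> s0 /cubeP xs; rewrite [leLHS]/Num.norm/= mx_normrE.
apply/bigmax_leP; split => // -[i k] _ /=; rewrite (ord1 i) !mxE.
by have /andP[h1 h2] := xs k; rewrite ger0_norm; lra.
Qed.

(* With eps of the order of the small cube, log_modulus eps v is at most
   ln eps + O(1) near a zero of v; it is O(1) near a nonzero point, and the
   drift of the means only makes up for half of ln eps. *)
Lemma zero_of_mean_close (z y : T) (s D : R) : 0 < s -> cube z s `<=` Q ->
  v z = 0 ->
  (forall eps r, 0 < eps -> 0 < r -> r <= s ->
    `|mean (log_modulus eps v) y r - mean (log_modulus eps v) z r| <= D / r ^+ n.+1) ->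
  v y = 0.
Proof.
move=> s0 sQ vz near_means; apply/rowP => k0; rewrite mxE.
apply: contrapT => /eqP vy0.
pose c := `|v y 0 k0| / 2; have c0 : 0 < c by rewrite divr_gt0 ?normr_gt0.
pose K := `|L| + 1; have K0 : 0 < K by rewrite ltr_wpDl.
have vK x x' k : `|v x 0 k - v x' 0 k| <= K * `|x - x'|.
  by rewrite (le_trans (vL _ _ _))// ler_wpM2r// (le_trans (ler_norm _))// lerDl.
(* On the cube of side [r] at [y], the coordinate [k0] of [v] varies by at most [c], half its size
   at [y], so it stays at least [c] in absolute value. *)
pose r := Num.min s (c / K).
have r0 : 0 < r by rewrite lt_min s0 divr_gt0.
have rs : r <= s by rewrite ge_min lexx.
have rc : K * r <= c by rewrite mulrC -ler_pdivlMr// ge_min lexx orbT.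
have rQ : cube z r `<=` Q by apply: subset_trans sQ; exact: cubeS.
have ln2 : 0 < ln 2 / 2 :> R by rewrite divr_gt0// ln_gt0// ltr1n.
have [C CP] := mean_drift r0 ln2 rQ.
have wL eps (eps0 : 0 < eps) := log_modulus_lipschitz eps0 vb vL.
have lower eps : 0 < eps -> ln c <= mean (log_modulus eps v) y r.
  move=> eps0; apply: (mean_ge (wL _ eps0) r0) => x xy.
  have cx : c <= `|v x 0 k0|.
    have h : `|v y 0 k0| <= `|v x 0 k0| + c.
      rewrite -lerBlDl (le_trans (lerB_dist _ _))// (le_trans (vK _ _ _))//.
      by rewrite (le_trans _ rc)// ler_pM2l// distrC cube_dist_le// ltW.
    by move: h; rewrite /c; lra.
  rewrite /log_modulus ler_pdivlMl// mulr_natl -lnXn//.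
  rewrite ler_ln ?posrE ?exprn_gt0//; last first.
    exact: lt_le_trans (exprn_gt0 2 eps0) (log_modulus_arg_ge _ _ _).
  apply: (@le_trans _ _ (v x 0 k0 ^+ 2)).
    by rewrite -[v x 0 k0 ^+ 2]real_normK ?num_real// lerXn2r ?nnegrE ?(ltW c0).
  rewrite (bigD1 k0)//= addrCA lerDl addr_ge0 ?sqr_ge0//.
  by apply: sumr_ge0 => i _; exact: sqr_ge0.
(* On the cube of side [eps] at the zero [z] each coordinate of [v] is at most [K * eps], so the
   argument of the logarithm is at most [eps ^+ 2 * B]. *)
pose B := 1 + M%:R * K ^+ 2 : R.
have B0 : 0 < B by rewrite ltr_wpDr// mulr_ge0// sqr_ge0.
have upper k (eps := r / 2 ^+ k) :
    mean (log_modulus eps v) z (r / 2 ^+ k) <= ln r - ln 2 * k%:R + 2^-1 * ln B.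
  have eps0 : 0 < eps by rewrite divr_gt0 ?exprn_gt0.
  apply: (mean_le (wL _ eps0) eps0) => x xz.
  have -> : ln r - ln 2 * k%:R + 2^-1 * ln B = 2^-1 * ln (eps ^+ 2 * B).
    have lneps : ln eps = ln r - ln 2 * k%:R.
      by rewrite /eps ln_div ?posrE ?exprn_gt0// lnXn// mulr_natr.
    by rewrite lnM ?posrE ?exprn_gt0// lnXn// lneps -mulr_natr; field.
  rewrite /log_modulus ler_pM2l ?invr_gt0// ler_ln ?posrE ?mulr_gt0 ?exprn_gt0//; last first.
    exact: lt_le_trans (exprn_gt0 2 eps0) (log_modulus_arg_ge _ _ _).
  rewrite mulrDr mulr1 lerD2l (_ : _ * (_ * _) = \sum_(i < M) (K * eps) ^+ 2); last first.
    by rewrite sumr_const card_ord -[RHS]mulr_natl; move: (eps) => q; ring.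
  apply: ler_sum => i _; rewrite -[v x 0 i ^+ 2]real_normK ?num_real//.
  have vxi : `|v x 0 i| <= K * eps.
    have := vK x z i; rewrite vz [(0 : 'rV__) _ _]mxE subr0 => /le_trans; apply.
    by rewrite ler_pM2l// cube_dist_le// ltW.
  by rewrite lerXn2r// nnegrE mulr_ge0// ltW.
pose F := C + D / r ^+ n.+1 + ln r + 2^-1 * ln B - ln c.
(* Chain of bounds: [ln c], mean at [y], mean at [z] on side [r], mean at [z] on side [r / 2 ^+ k].
   The last loses [ln 2 * k%:R] and the drift returns half of it; [F] does not depend on [k], which
   is absurd for large [k]. *)
have contra k : ln 2 / 2 * k%:R <= F.
  have eps0 : 0 < r / 2 ^+ k by rewrite divr_gt0 ?exprn_gt0.
  have h1 := lower _ eps0; have h2 := upper k.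
  have := CP _ _ (wL _ eps0) (vosc eps0) k; have := near_means _ _ eps0 r0 rs.
  rewrite !ler_norml /F => /andP[_ h3] /andP[_ h4].
  move: h1 h2 h3 h4; cbv zeta; move: (mean _ y r) (mean _ z r) (mean _ z (r / _)).
  move: (D / _) (ln r) (ln B) (ln c) (ln 2) => D' lr lB lc l2 my mz mk; nra.
have /archi_boundP : 0 <= `|F| / (ln 2 / 2) by rewrite divr_ge0// ltW.
rewrite ltNge => /negP; apply; rewrite ler_pdivlMr// mulrC (le_trans (contra _))//.
exact: ler_norm.
Qed.

(** Means over the two translated cubes differ by a bound that need not be small, only independent
    of [eps]. It is symmetric in the two points; the equivalence lets a positive [t] serve for moves
    in both senses. *)
Lemma zero_translate j (z : T) (s t : R) : 0 < s -> 0 < t ->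
  (forall (x : T) r, cube z s x -> 0 <= r <= t -> Q (x + r *: e j)) ->
  v z = 0 <-> v (z + t *: e j) = 0.
Proof.
move=> s0 t0 zQ.
have wL eps (eps0 : 0 < eps) := log_modulus_lipschitz eps0 vb vL.
have close eps r : 0 < eps -> 0 < r -> r <= s ->
    `|mean (log_modulus eps v) (z + t *: e j) r - mean (log_modulus eps v) z r| <=
    t * (\int[mu]_(x in Q) W x) / r ^+ n.+1.
  move=> eps0 r0 rs; apply: (mean_translate_le (wL _ eps0) (vosc eps0) r0 t0).
  by move=> x q xz; apply: zQ; exact: cubeS xz.
split => v0.
  apply: (zero_of_mean_close s0 _ v0 close) => x xz.
  by have := zQ x 0 xz; rewrite scale0r addr0; apply; rewrite lexx ltW.
apply: (zero_of_mean_close (D := t * (\int[mu]_(x in Q) W x)) s0 _ v0) => [x xz|eps r *].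
  rewrite -(subrK (t *: e j) x); apply: zQ; last by rewrite lexx ltW.
  by move: xz => /cubeP h; apply/cubeP => i; have := h i; rewrite !mxE; lra.
by rewrite distrC; exact: close.
Qed.

End zero_propagation.

(** * Projection onto a cube, for a global Lipschitz extension *)

Section clamping.
Context {R : realType}.

Lemma enorm_le_norm m (x : 'rV[R]_m) : enorm x <= m%:R * `|x|.
Proof.
rewrite -[leRHS]ger0_norm ?mulr_ge0// -sqrtr_sqr ler_wsqrtr//.
apply: (@le_trans _ _ (\sum_(i < m) `|x| ^+ 2)).
  apply: ler_sum => i _; rewrite -[x 0 i ^+ 2]real_normK ?num_real//.
  by rewrite lerXn2r ?nnegrE// norm_coord_le.
rewrite sumr_const card_ord -[leLHS]mulr_natl exprMn ler_wpM2r ?sqr_ge0//.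
by rewrite -natrX ler_nat; case: m {x} => // m; rewrite leq_pmull.
Qed.

Lemma norm_coord_le_enorm m (x : 'rV[R]_m) k : `|x 0 k| <= enorm x.
Proof.
rewrite -sqrtr_sqr ler_wsqrtr// (bigD1 k)//= lerDl sumr_ge0// => i _.
exact: sqr_ge0.
Qed.

(** For [r >= 0] this is the coordinatewise projection onto the closed sup-norm ball. Composition
    with it turns a map Lipschitz on that ball into a bounded map that is Lipschitz everywhere. *)
Definition clamp m (c : 'rV[R]_m) (r : R) (x : 'rV[R]_m) : 'rV[R]_m :=
  \row_i Num.max (c 0 i - r) (Num.min (c 0 i + r) (x 0 i)).

Lemma clamp_dist_le m (c : 'rV[R]_m) (r : R) (x : 'rV[R]_m) :
  0 <= r -> forall i, `|clamp c r x 0 i - c 0 i| <= r.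
Proof.
move=> r0 i; rewrite mxE ler_norml /Num.max /Num.min.
by repeat case: ifP; lra.
Qed.

Lemma clamp_nonexpansive m (c : 'rV[R]_m) (r : R) (x y : 'rV[R]_m) :
  `|clamp c r x - clamp c r y| <= `|x - y|.
Proof.
rewrite [leLHS]/Num.norm/= mx_normrE; apply/bigmax_leP; split => // -[i k] _ /=.
rewrite (ord1 i) !mxE (le_trans _ (norm_coord_le _ k))// !mxE.
rewrite /Num.max /Num.min.
by repeat case: ifP; rewrite ler_norml; have := ler_norm (x 0 k - y 0 k);
  have := ler_norm (- (x 0 k - y 0 k)); rewrite normrN; lra.
Qed.

Lemma clamp_id m (c : 'rV[R]_m) (r : R) (x : 'rV[R]_m) :
  (forall i, `|x 0 i - c 0 i| <= r) -> clamp c r x = x.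
Proof.
move=> xc; apply/rowP => i; rewrite mxE; have := xc i; rewrite ler_norml => /andP[h1 h2].
by rewrite min_r ?max_r//; lra.
Qed.

Lemma rV_ballP m (c x : 'rV[R]_m.+1) (r : R) :
  ball c r x <-> forall i, `|x 0 i - c 0 i| < r.
Proof.
split=> [[_ h] i|h]; first by have := h 0 i; rewrite /ball/= distrC.
split=> [|i j]; first exact: le_lt_trans (normr_ge0 _) (h 0).
by rewrite /ball/= (ord1 i) distrC.
Qed.

End clamping.

(** * Zeros spread over a small ball *)

Section local_propagation.
Context {R : realType} {n M : nat}.
Local Notation T := 'rV[R]_n.+1.
Local Notation Rn := (measurableRn R n).
Local Notation mu := (@lebesgue_Rn R n).
Local Notation e j := (delta_mx 0 j : T).
Variables (Om : set T) (V : T -> R) (u : T -> 'rV[R]_M).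
Hypothesis Om_open : open Om.
Hypothesis V_Ln : Lploc n.+1 Om V.
Hypothesis u_lip : locally_lipschitz Om u.
Hypothesis u_grad : {ae mu, forall x, Om x -> grad_norm u x <= V x * enorm (u x)}.

(** [V] has no prescribed sign, but the inequality itself makes its right-hand side nonnegative, so
    it can be squared; then all directions other than [j] are dropped. *)
Lemma sqr_partial_le (x : T) j : grad_norm u x <= V x * enorm (u x) ->
  \sum_k partial u k j x ^+ 2 <= `|V x| ^+ 2 * \sum_k u x 0 k ^+ 2.
Proof.
move=> gx; have S0 : 0 <= \sum_k u x 0 k ^+ 2 by apply: sumr_ge0 => k _; exact: sqr_ge0.
have G0 i : 0 <= \sum_k partial u k i x ^+ 2 by apply: sumr_ge0 => k _; exact: sqr_ge0.
have -> : `|V x| ^+ 2 * \sum_k u x 0 k ^+ 2 = (V x * enorm (u x)) ^+ 2.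
  by rewrite exprMn sqr_sqrtr// real_normK ?num_real.
apply: (@le_trans _ _ (grad_norm u x ^+ 2)); last first.
  by rewrite lerXn2r ?nnegrE ?sqrtr_ge0// (le_trans (sqrtr_ge0 _) gx).
rewrite sqr_sqrtr ?sumr_ge0// (bigD1 j)//= lerDl; exact: sumr_ge0.
Qed.

(** The propagation along the axes is applied to the clamped map [v], equal to [u] near [c], and two
    points of the ball are joined by changing one coordinate at a time. *)
Lemma zero_locally (c : T) : Om c ->
  exists2 r, 0 < r & forall z y, ball c r z -> ball c r y -> u z = 0 -> u y = 0.
Proof.
move=> Omc; have [U [/nbhs_ballP[r' /= r'0 r'U] UOm [L uL]]] := u_lip Omc.
pose r := r' / 2; have r0 : 0 < r by rewrite divr_gt0.
have rU (x : T) : (forall i, `|x 0 i - c 0 i| <= r) -> U x.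
  move=> xc; apply/r'U/rV_ballP => i; rewrite (le_lt_trans (xc i))//.
  by rewrite /r ltr_pdivrMr// ltr_pMr// ltr1n.
pose v := u \o clamp c r.
have vu (x : T) : (forall i, `|x 0 i - c 0 i| <= r) -> v x = u x.
  by move=> xc; rewrite /v /= clamp_id.
pose L' := `|L| * n.+1%:R.
have vdist x y k : `|v x 0 k - v y 0 k| <= L' * `|clamp c r x - clamp c r y|.
  have := norm_coord_le_enorm (v x - v y) k; rewrite !mxE => /le_trans; apply.
  have Uc z : U (clamp c r z) by apply: rU; apply: clamp_dist_le; exact: ltW.
  rewrite (le_trans (uL _ _ (Uc _) (Uc _)))//.
  rewrite /L' -mulrA (@le_trans _ _ (`|L| * enorm (clamp c r x - clamp c r y)))//.
    by rewrite ler_wpM2r ?sqrtr_ge0// ler_norm.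
  by rewrite ler_wpM2l// enorm_le_norm.
have L'0 : 0 <= L' by rewrite mulr_ge0.
have vL x y k : `|v x 0 k - v y 0 k| <= L' * `|x - y|.
  by rewrite (le_trans (vdist _ _ _))// ler_wpM2l// clamp_nonexpansive.
pose b := `|u c| + L' * r.
have vb x k : `|v x 0 k| <= b.
  rewrite -[v x 0 k](subrK (v c 0 k)) addrC (le_trans (ler_normD _ _))// lerD//.
    by rewrite vu ?norm_coord_le// => i; rewrite subrr normr0 ltW.
  rewrite (le_trans (vdist _ _ _))// ler_wpM2l//.
  rewrite (clamp_id (x := c)); last by move=> i; rewrite subrr normr0 ltW.
  rewrite [leLHS]/Num.norm/= mx_normrE; apply/bigmax_leP.
  split=> [|[i j] _ /=]; first exact: ltW.
  by rewrite (ord1 i) [_ 0 j]mxE [(- c) 0 j]mxE clamp_dist_le// ltW.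
pose Q : set Rn := ball c r.
have mQ : measurable Q by apply: open_measurable_Rn; exact: ball_open.
have mOm : measurable (Om : set Rn) by exact: open_measurable_Rn.
have QOm : Q `<=` Om.
  by move=> x /rV_ballP xc; apply/UOm/rU => i; exact/ltW.
have Q_fin : (mu Q < +oo)%E.
  apply: le_lt_trans (lebesgue_Rn_box_lty (c - const_mx r, c + const_mx r)).
  apply: le_measure; rewrite ?inE//; first exact: measurable_box.
  move=> x /rV_ballP xc i; rewrite !mxE; have := xc i.
  by rewrite ltr_norml; lra.
pose W x := `|V x|.
have W0 x : 0 <= W x by exact: normr_ge0.
have mV : measurable_fun Q (V : Rn -> R).
  exact: (measurable_funS mOm QOm V_Ln.1).
have mW : measurable_fun Q (W : Rn -> R) by exact: measurableT_comp.
have iWn : mu.-integrable Q (EFin \o ((fun x => W x ^+ n.+1) : Rn -> R)).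
  apply/integrableP; split; first by apply/measurable_EFinP; exact: measurable_funX.
  (* Local integrability is stated on compact sets: [K] is the closed ball, still inside [U] because
     [r] is half of [r']. *)
  pose K : set T := [set x | forall i, `[c 0 i - r, c 0 i + r]%classic (x ord0 i)].
  have KE x : K x -> forall i, `|x 0 i - c 0 i| <= r.
    by move=> Kx i; have := Kx i; rewrite /= in_itv/= ler_norml; lra.
  have cI i : compact `[c 0 i - r, c 0 i + r]%classic by exact: segment_compact.
  have cK : compact K by apply: (rV_compact cI).
  have KOm : K `<=` Om by move=> x /KE; move/rU; exact: UOm.
  apply: le_lt_trans (V_Ln.2 K KOm cK).
  have mK : measurable (K : set Rn).
    rewrite -(setCK K); apply: measurableC; apply: open_measurable_Rn.
    by apply: closed_openC; apply: compact_closed => //; exact: norm_hausdorff.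
  rewrite (_ : \int[mu]_(x in Q) _ = \int[mu]_(x in Q) (`|V x| ^+ n.+1)%:E)%E; last first.
    by apply: eq_integral => x _; rewrite /= ger0_norm// exprn_ge0.
  apply: ge0_subset_integral => //.
  - apply/measurable_EFinP; apply: measurable_funX; apply: measurableT_comp => //.
    exact: (measurable_funS mOm KOm V_Ln.1).
  move=> x /rV_ballP xc i; rewrite /= in_itv/=; have := xc i.
  by rewrite ltr_norml; lra.
have i1 : mu.-integrable Q (EFin \o (cst 1 : Rn -> R)).
  apply: (integrableS (measurable_box (c - const_mx r, c + const_mx r))) => //.
    move=> x /rV_ballP xc i; rewrite !mxE; have := xc i.
    by rewrite ltr_norml; lra.
  apply: (@lipschitz_integrable_box _ _ (cst 1) 0) => x y.
  by rewrite subrr normr0 mul0r.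
(* [young_le] with [d = 1] bounds [W] by one plus its power, on a set of finite measure. *)
have iW : mu.-integrable Q (EFin \o (W : Rn -> R)).
  apply: (le_integrable mQ _ _ (integrableD mQ i1 iWn)); first exact/measurable_EFinP.
  move=> x _ /=; rewrite lee_fin !ger0_norm ?addr_ge0 ?exprn_ge0//.
  by have := @young_le R n (W x) 1 (W0 x) ltr01; rewrite expr1n divr1.
have vosc eps : 0 < eps -> oscillation_bound Q W (log_modulus eps v).
  move=> eps0 j h A B h0 mA mB BQ AB.
  apply: (@integral_translate_diff_le _ _ _ W _ j h A B
    (log_modulus_lipschitz eps0 vb vL)) => //.
  - by apply: le_lt_trans Q_fin; apply: le_measure; rewrite ?inE.
  - exact: measurable_funS mW.
  have Fae : Filter (almost_everywhere mu) := ae_filter_ringOfSetsType mu.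
  have dv : {ae mu, forall x, forall k, derivable (fun y => v y 0 k) x (e j)}.
    apply: (@filter_forall _ _ (fun k x => derivable (fun y => v y 0 k) x (e j))) => k.
    exact: (lipschitz_ae_derivable_coord (L := L')).
  apply: filterS2 dv u_grad => x dvx gx Bx.
  have Qx := BQ _ Bx.
  apply: log_modulus_derive_le => //.
  (* [Q] is open, so the partial derivatives of [v] and [u] agree there and the hypothesis on [u]
     passes to [v]. *)
  have nearu k : \forall y \near x, v y 0 k = u y 0 k.
    have : nbhs x Q by apply: open_nbhs_nbhs; split => //; exact: ball_open.
    by apply: filterS => y /rV_ballP yc; rewrite vu// => i; exact: ltW.
  have xc : v x = u x by apply: vu => i; apply/ltW; move/rV_ballP : Qx.
  have := sqr_partial_le j (gx (QOm _ Qx)); rewrite xc.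
  under eq_bigr do rewrite /partial -(near_eq_derive _ (nearu _)).
  by [].
(* The corners stay within [r / 2] of [c], so the cubes of side [s] swept along the path stay within
   three quarters of [r], inside [Q]. *)
pose s := r / 4; have s0 : 0 < s by rewrite divr_gt0.
exists (r / 2); first by rewrite divr_gt0.
move=> z y /rV_ballP zc /rV_ballP yc uz.
pose p (m : nat) : T := \row_i if (i < m)%N then y 0 i else z 0 i.
have pc m i : `|p m 0 i - c 0 i| < r / 2 by rewrite mxE; case: ifP.
have vp m : v (p m) = u (p m).
  by apply: vu => i; rewrite (le_trans (ltW (pc m i)))// ler_pdivrMr// ler_peMr ?ltW// ltr1n.
have path j (q q' : T) (t : R) : (forall i, `|q 0 i - c 0 i| < r / 2) ->
    (forall i, `|q' 0 i - c 0 i| < r / 2) -> q' = q + t *: e j -> 0 < t ->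
    v q = 0 <-> v q' = 0.
  move=> qc q'c q'E t0; subst q'; apply: (zero_translate mQ W0 iW iWn vb vL vosc s0 t0).
  move=> x h /cubeP xq /andP[h0 ht]; apply/rV_ballP => i.
  have := xq i; have := qc i; have := q'c i; have := r0.
  rewrite !mxE ?eqxx/= !ltr_norml /s; case: (i == j).
    by rewrite !mulr1; lra.
  by rewrite !mulr0; lra.
have vzero m : (m <= n.+1)%N -> v (p m) = 0.
  elim: m => [_|m IH mn].
    rewrite vp -[RHS]uz; congr u; apply/rowP => i; by rewrite mxE.
  have {}IH := IH (ltnW mn).
  pose j := Ordinal mn; pose t := y 0 j - z 0 j.
  have pE : p m.+1 = p m + t *: e j.
    apply/rowP => i; rewrite !mxE eqxx/= ltnS leq_eqVlt -val_eqE/=.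
    case: eqP => [im|_]; last by rewrite mulr0 addr0.
    have -> : i = j by exact: val_inj.
    by rewrite ltnn mulr1 /t addrC subrK.
  (* For a negative [t] the endpoints are exchanged and the equivalence is read backwards. *)
  have [t0|t0|t0] := ltgtP t 0.
  - have pE' : p m = p m.+1 + (- t) *: e j by rewrite pE scaleNr addrK.
    by apply/(path j _ _ (- t) (pc _) (pc _) pE'); rewrite ?oppr_gt0.
  - exact/(path j _ _ t (pc _) (pc _) pE).
  - by rewrite pE t0 scale0r addr0.
have -> : y = p n.+1 by apply/rowP => i; rewrite mxE ltn_ord.
by rewrite -vp vzero.
Qed.

End local_propagation.

(** * From local to global by connectedness *)

Theorem theorem1p3 (R : realType) (n M : nat) (Om : set 'rV[R]_n.+1)
    (V : 'rV[R]_n.+1 -> R) (u : 'rV[R]_n.+1 -> 'rV[R]_M) (x0 : 'rV[R]_n.+1)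
    (Om_open : open Om) (Om_connected : connected Om)
    (V_Ln : Lploc n.+1 Om V)
    (u_lip : locally_lipschitz Om u)
    (u_grad : {ae @lebesgue_Rn R n,
       forall x, Om x -> grad_norm u x <= V x * enorm (u x)})
    (x0_in : Om x0) (u_x0 : u x0 = 0) :
  forall x, Om x -> u x = 0.
Proof.
have loc := zero_locally Om_open V_Ln u_lip u_grad.
pose B := Om `&` [set x | u x = 0].
suff BOm : B = Om by move=> x; rewrite -BOm => -[].
apply: Om_connected; first by exists x0.
- exists B; last by rewrite setIA setIid.
  rewrite openE => z [Omz uz]; have [r r0 rP] := loc z Omz.
  have : nbhs z (Om `&` ball z r).
    by apply: filterI; [exact: open_nbhs_nbhs|exact: nbhsx_ballx].
  by apply: filterS => y [Omy zy]; split => //; apply: (rP z) => //; exact: ballxx.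
(* Closedness also follows from local propagation: a zero in the ball around a point of the closure
   forces a zero at that point. *)
exists (closure B); first exact: closed_closure.
apply/seteqP; split => [x Bx|x [Omx Bx]].
  by split; [exact: Bx.1|exact: subset_closure].
split => //; have [r r0 rP] := loc x Omx.
have [z [[_ uz] xz]] := Bx _ (nbhsx_ballx x r r0).
by apply: (rP z) => //; exact: ballxx.
Qed.
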